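(* Let $(M,J,g)$ be a conformal Kähler manifold with Norden metric of dimension $2n\ge6$. Let $\lambda_1,\dots,\lambda_8\in\mathbb{R}$ with $\lambda_7=-\lambda_5$ and $\lambda_8=-\lambda_6$, and let $R'$ be the $(0,4)$ curvature tensor of the complex connection $\nabla'_xy=\nabla_xy+Q(x,y)$ with $$\begin{aligned}Q(x,y)={}&\tfrac{1}{2n}\left[\theta(Jy)x-g(x,y)J\Omega\right]+\tfrac1n\big\{\lambda_1\theta(x)y+\lambda_2\theta(x)Jy+\lambda_3\theta(Jx)y+\lambda_4\theta(Jx)Jy\\&+\lambda_5[\theta(y)x-\theta(Jy)Jx]+\lambda_6[\theta(y)Jx+\theta(Jy)x]\\&+\lambda_7[g(x,y)\Omega-g(x,Jy)J\Omega]+\lambda_8[g(x,Jy)\Omega+g(x,y)J\Omega]\big\}.\end{aligned}$$ Then the Bochner curvature tensor of $\nabla'$ is conformally invariant under the transformation $\overline g=e^{2u}g$ with $u$ pluriharmonic, i.e. $$B(\overline R')=e^{2u}B(R'),$$ where $\overline R'$ is the $(0,4)$ curvature tensor of the connection $\overline\nabla'$ constructed in the same way (with the same $\lambda_i$) from $(M,J,\overline g)$, and $B(\overline R')$ is formed with respect to $\overline g$.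
   Context: An almost complex manifold with Norden metric $(M,J,g)$ is a smooth $2n$-dimensional manifold with an almost complex structure $J$ ($J^2=-\mathrm{id}$) and a pseudo-Riemannian metric $g$ with $g(Jx,Jy)=-g(x,y)$. Put $\widetilde g(x,y)=g(x,Jy)$. Let $\nabla$ be the Levi-Civita connection of $g$ and $F(x,y,z)=g((\nabla_xJ)y,z)$. The Lie 1-forms are $\theta(x)=g^{ij}F(e_i,e_j,x)$ (for any local basis $\{e_i\}$, $(g^{ij})$ the inverse matrix of $g$) and $\theta^*=\theta\circ J$; the Lie vector $\Omega$ is defined by $\theta(x)=g(x,\Omega)$. $(M,J,g)$ is a $\mathcal{W}_1$-manifold if $$F(x,y,z)=\tfrac{1}{2n}\left[g(x,y)\theta(z)+g(x,Jy)\theta(Jz)+g(x,z)\theta(y)+g(x,Jz)\theta(Jy)\right].$$ A conformal Kähler manifold with Norden metric is a $\mathcal{W}_1$-manifold with $d\theta=d\theta^*=0$. A connection $D$ is complex if $DJ=0$. For a connection $D$, $R^D(x,y)z=D_xD_yz-D_yD_xz-D_{[x,y]}z$; the $(0,4)$ tensors are $R'(x,y,z,w)=g(R'(x,y)z,w)$ and $\overline R'(x,y,z,w)=\overline g(\overline R'(x,y)z,w)$. A smooth function $u$ is pluriharmonic if $du\circ J$ is closed. Bars denote objects constructed by the same definitions from $\overline g$ in place of $g$ (Levi-Civita connection $\overline\nabla$, Lie 1-form $\overline\theta$, Lie vector $\overline\Omega$, connection $\overline\nabla'$). A $(0,4)$-tensor $L$ is a Kähler curvature-like tensor if it is skew in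 the first two and in the last two arguments, satisfies the first Bianchi identity, and $L(x,y,Jz,Jw)=-L(x,y,z,w)$ (under the hypotheses, $R'$ and $\overline R'$ are such tensors). Put $\rho(L)(y,z)=g^{ij}L(e_i,y,z,e_j)$, $\tau(L)=g^{ij}\rho(L)(e_i,e_j)$, $\tau^*(L)=g^{ij}\rho(L)(e_i,Je_j)$. For a Kähler curvature-like tensor $L$ and $2n\ge6$ the Bochner tensor (with respect to $g$) is $$B(L)=L-\tfrac{1}{2(n-2)}\{\psi_1-\psi_2\}(\rho(L))+\tfrac{1}{4(n-1)(n-2)}\left\{\tau(L)(\pi_1-\pi_2)+\tau^*(L)\pi_3\right\},$$ where $$\psi_1(S)(x,y,z,w)=g(y,z)S(x,w)-g(x,z)S(y,w)+g(x,w)S(y,z)-g(y,w)S(x,z),$$ $$\psi_2(S)(x,y,z,w)=g(y,Jz)S(x,Jw)-g(x,Jz)S(y,Jw)+g(x,Jw)S(y,Jz)-g(y,Jw)S(x,Jz),$$ $\pi_1=\frac12\psi_1(g)$, $\pi_2=\frac12\psi_2(g)$, $\pi_3=-\psi_1(\widetilde g)=\psi_2(\widetilde g)$. *)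

(* Defs.v *)
From HB Require Import structures.
From mathcomp Require Import all_boot all_order all_algebra.
From mathcomp Require Import all_classical all_reals all_analysis.

Set Implicit Arguments.
Unset Strict Implicit.
Unset Printing Implicit Defensive.
Import Order.TTheory GRing.Theory Num.Theory.
Import numFieldNormedType.Exports.
Local Open Scope classical_set_scope.
Local Open Scope ring_scope.

(* C^k on the open set W: the iterated directional derivatives up to order k
   exist and are continuous at the points of W.  The functions are total, but
   on an open W nothing depends on their values outside W. *)
Fixpoint Ck_on (R : realType) (V V' : normedModType R) (k : nat)
    (W : set V) (f : V -> V') : Prop :=
  (forall q, W q -> {for q, continuous f}) /\
  (if k is k'.+1 then
     forall v, (forall q, W q -> derivable f q v) /\
               Ck_on k' W (fun q => 'D_v f q)
   else True).

Definition smooth_on (R : realType) (V V' : normedModType R)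
    (W : set V) (f : V -> V') : Prop :=
  forall k, Ck_on k W f.

(* A smooth m-manifold: a Hausdorff second countable space with a smooth atlas
   indexed by [chart].  [coord c] is a homeomorphism of the open set [dom c]
   onto an open subset of R^m, with inverse [param c]; both maps are total with
   irrelevant values elsewhere. *)
Record manifold (R : realType) (m : nat) := Manifold {
  pt :> topologicalType;
  chart : Type;
  dom : chart -> set pt;
  coord : chart -> pt -> 'rV[R]_m;
  param : chart -> 'rV[R]_m -> pt;
  pt_hausdorff : hausdorff_space pt;
  pt_second_countable : @second_countable pt;
  dom_cover : forall p, exists c, dom c p;
  dom_open : forall c, open (dom c);
  cod_open : forall c, open (coord c @` dom c);
  coordK : forall c p, dom c p -> param c (coord c p) = p;
  coord_continuous : forall c p, dom c p -> {for p, continuous (coord c)};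
  param_continuous : forall c q, (coord c @` dom c) q ->
    {for q, continuous (param c)};
  transition_smooth : forall c c',
    smooth_on (coord c @` (dom c `&` dom c')) (coord c' \o param c)
}.

(* Geometric objects in one fixed chart: vector fields are functions
   'rV_m -> 'rV_m, a metric is given by the Gram matrix of the coordinate frame,
   and an endomorphism acts on row vectors by multiplication on the right. *)
Section LocalGeometry.
Context (R : realType) (m : nat).
Local Notation E := 'rV[R]_m.
Local Notation vf := (E -> E).
Local Notation fn := (E -> R).

(* X f, or the componentwise derivative of a vector field along X *)
Definition along (V : normedModType R) (X : vf) (f : E -> V) : E -> V :=
  fun q => 'D_(X q) f q.

Definition bracket (X Y : vf) : vf := fun q => along X Y q - along Y X q.

Definition frame (a : 'I_m) : vf := fun _ => delta_mx 0 a.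

Definition app (J : E -> 'M[R]_m) (X : vf) : vf := fun q => X q *m J q.

Definition inner (g : E -> 'M[R]_m) (X Y : vf) : fn :=
  fun q => (X q *m g q *m (Y q)^T) 0 0.

(* the g-trace g^{ab} S(e_a, e_b) in the coordinate frame *)
Definition trace (g : E -> 'M[R]_m) (S : vf -> vf -> fn) : fn :=
  fun q => \sum_(a < m) \sum_(b < m) invmx (g q) a b * S (frame a) (frame b) q.

Definition ext_d (w : vf -> fn) (X Y : vf) : fn :=
  fun q => along X (w Y) q - along Y (w X) q - w (bracket X Y) q.

Definition nabla_endo (J : E -> 'M[R]_m) (D : vf -> vf -> vf) (X Y : vf) : vf :=
  fun q => D X (app J Y) q - app J (D X Y) q.

Definition F_tensor (J g : E -> 'M[R]_m) (D : vf -> vf -> vf)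
    (X Y Z : vf) : fn :=
  inner g (nabla_endo J D X Y) Z.

Definition lie_form (J g : E -> 'M[R]_m) (D : vf -> vf -> vf) (X : vf) : fn :=
  trace g (fun Y Z => F_tensor J g D Y Z X).

Definition lie_form_star (J g : E -> 'M[R]_m) (D : vf -> vf -> vf)
    (X : vf) : fn :=
  lie_form J g D (app J X).

Definition curvature (D : vf -> vf -> vf) (X Y Z : vf) : vf :=
  fun q => D X (D Y Z) q - D Y (D X Z) q - D (bracket X Y) Z q.

Definition curvature4 (g : E -> 'M[R]_m) (D : vf -> vf -> vf)
    (X Y Z W : vf) : fn :=
  inner g (curvature D X Y Z) W.

Definition assoc_metric (J g : E -> 'M[R]_m) (X Y : vf) : fn :=
  inner g X (app J Y).

Definition psi1 (g : E -> 'M[R]_m) (S : vf -> vf -> fn) (X Y Z W : vf) : fn :=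
  fun q => inner g Y Z q * S X W q - inner g X Z q * S Y W q
         + inner g X W q * S Y Z q - inner g Y W q * S X Z q.

Definition psi2 (J g : E -> 'M[R]_m) (S : vf -> vf -> fn)
    (X Y Z W : vf) : fn :=
  fun q => inner g Y (app J Z) q * S X (app J W) q
         - inner g X (app J Z) q * S Y (app J W) q
         + inner g X (app J W) q * S Y (app J Z) q
         - inner g Y (app J W) q * S X (app J Z) q.

Definition pi1 (g : E -> 'M[R]_m) (X Y Z W : vf) : fn :=
  fun q => 2^-1 * psi1 g (inner g) X Y Z W q.

Definition pi2 (J g : E -> 'M[R]_m) (X Y Z W : vf) : fn :=
  fun q => 2^-1 * psi2 J g (inner g) X Y Z W q.

Definition pi3 (J g : E -> 'M[R]_m) (X Y Z W : vf) : fn :=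
  fun q => - psi1 g (assoc_metric J g) X Y Z W q.

Definition ricci (g : E -> 'M[R]_m) (L : vf -> vf -> vf -> vf -> fn)
    (Y Z : vf) : fn :=
  trace g (fun A B => L A Y Z B).

Definition scal (g : E -> 'M[R]_m) (L : vf -> vf -> vf -> vf -> fn) : fn :=
  trace g (ricci g L).

Definition scal_star (J g : E -> 'M[R]_m)
    (L : vf -> vf -> vf -> vf -> fn) : fn :=
  trace g (fun A B => ricci g L A (app J B)).

(* [n] is half the dimension m *)
Definition bochner (n : nat) (J g : E -> 'M[R]_m)
    (L : vf -> vf -> vf -> vf -> fn) (X Y Z W : vf) : fn :=
  fun q =>
    L X Y Z W q
    - (2 * (n%:R - 2))^-1 *
        (psi1 g (ricci g L) X Y Z W q - psi2 J g (ricci g L) X Y Z W q)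
    + (4 * (n%:R - 1) * (n%:R - 2))^-1 *
        (scal g L q * (pi1 g X Y Z W q - pi2 J g X Y Z W q)
         + scal_star J g L q * pi3 J g X Y Z W q).

Definition Q_tensor (n : nat) (l1 l2 l3 l4 l5 l6 l7 l8 : R)
    (J g : E -> 'M[R]_m) (D : vf -> vf -> vf) (Omega : vf) (X Y : vf) : vf :=
  let th := lie_form J g D in
  let JX := app J X in
  let JY := app J Y in
  let JOmega := app J Omega in
  fun q =>
    (2 * n%:R)^-1 *: (th JY q *: X q - inner g X Y q *: JOmega q)
    + n%:R^-1 *:
      ((l1 * th X q) *: Y q + (l2 * th X q) *: JY q
       + (l3 * th JX q) *: Y q + (l4 * th JX q) *: JY q
       + l5 *: (th Y q *: X q - th JY q *: JX q)
       + l6 *: (th Y q *: JX q + th JY q *: X q)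
       + l7 *: (inner g X Y q *: Omega q - inner g X JY q *: JOmega q)
       + l8 *: (inner g X JY q *: Omega q + inner g X Y q *: JOmega q)).

Definition nabla' (n : nat) (l1 l2 l3 l4 l5 l6 l7 l8 : R)
    (J g : E -> 'M[R]_m) (D : vf -> vf -> vf) (Omega : vf) (X Y : vf) : vf :=
  fun q => D X Y q + Q_tensor n l1 l2 l3 l4 l5 l6 l7 l8 J g D Omega X Y q.

End LocalGeometry.

(* Objects on a manifold are given by their expressions in all charts, subject
   to the compatibility conditions below on the overlaps of charts. *)
Section Manifold.
Context (R : realType) (m : nat) (M : manifold R m).
Local Notation E := 'rV[R]_m.
Local Notation vf := (E -> E).

Definition cod (c : chart M) : set E := @coord R m M c @` @dom R m M c.

Definition overlap (c c' : chart M) : set E :=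
  @coord R m M c @` (@dom R m M c `&` @dom R m M c').

Definition transition (c c' : chart M) : E -> E :=
  @coord R m M c' \o @param R m M c.

Definition local_open (c : chart M) (W : set E) : Prop :=
  open W /\ W `<=` cod c.

Definition vector_field : Type := chart M -> E -> E.

(* for metrics and for endomorphism fields *)
Definition matrix_field : Type := chart M -> E -> 'M[R]_m.

Definition connection : Type := chart M -> vf -> vf -> vf.

Definition smooth_function (u : M -> R) : Prop :=
  forall c, smooth_on (cod c) (u \o @param R m M c).

Record is_almost_complex (J : matrix_field) : Prop := {
  almost_complex_smooth : forall c, smooth_on (cod c) (J c);
  almost_complex_compat : forall c c' q (v : E), overlap c c' q ->
    'd (transition c c') q (v *m J c q) =
    'd (transition c c') q v *m J c' (transition c c' q);
  almost_complex_sq : forall c q, cod c q -> J c q *m J c q = - 1%:M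
}.

Record is_metric (g : matrix_field) : Prop := {
  metric_smooth : forall c, smooth_on (cod c) (g c);
  metric_compat : forall c c' q (v w : E), overlap c c' q ->
    v *m g c q *m w^T =
    'd (transition c c') q v *m g c' (transition c c' q)
      *m ('d (transition c c') q w)^T;
  metric_sym : forall c q, cod c q -> (g c q)^T = g c q;
  metric_nondegenerate : forall c q, cod c q -> g c q \in unitmx
}.

(* Affine connections as operators on the vector fields of every open subset W
   of every chart.  Locality is part of the axioms: taking for f the indicator
   function of the complement of W shows that D X Y on W depends only on the
   restrictions of X and Y to W. *)
Record is_connection (D : connection) : Prop := {
  connection_smooth : forall c W X Y, local_open c W ->
    smooth_on W X -> smooth_on W Y -> smooth_on W (D c X Y);
  connection_lin : forall c W (f : E -> R) X1 X2 Y, local_open c W ->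
    smooth_on W f -> smooth_on W X1 -> smooth_on W X2 -> smooth_on W Y ->
    forall q, W q ->
    D c (fun x => f x *: X1 x + X2 x) Y q = f q *: D c X1 Y q + D c X2 Y q;
  connection_add : forall c W X Y1 Y2, local_open c W ->
    smooth_on W X -> smooth_on W Y1 -> smooth_on W Y2 ->
    forall q, W q ->
    D c X (fun x => Y1 x + Y2 x) q = D c X Y1 q + D c X Y2 q;
  connection_leibniz : forall c W (f : E -> R) X Y, local_open c W ->
    smooth_on W f -> smooth_on W X -> smooth_on W Y ->
    forall q, W q ->
    D c X (fun x => f x *: Y x) q = along X f q *: Y q + f q *: D c X Y q;
  connection_compat : forall c c' W X Y X' Y',
    open W -> W `<=` overlap c c' ->
    smooth_on W X -> smooth_on W Y ->
    (forall q, W q ->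
       X' (transition c c' q) = 'd (transition c c') q (X q)) ->
    (forall q, W q ->
       Y' (transition c c' q) = 'd (transition c c') q (Y q)) ->
    smooth_on (transition c c' @` W) X' ->
    smooth_on (transition c c' @` W) Y' ->
    forall q, W q ->
    D c' X' Y' (transition c c' q) = 'd (transition c c') q (D c X Y q)
}.

Record is_levi_civita (g : matrix_field) (D : connection) : Prop := {
  levi_civita_connection : is_connection D;
  levi_civita_torsion : forall c W X Y, local_open c W ->
    smooth_on W X -> smooth_on W Y ->
    forall q, W q -> D c X Y q - D c Y X q = bracket X Y q;
  levi_civita_metric : forall c W X Y Z, local_open c W ->
    smooth_on W X -> smooth_on W Y -> smooth_on W Z ->
    forall q, W q ->
    along X (inner (g c) Y Z) q =
    inner (g c) (D c X Y) Z q + inner (g c) Y (D c X Z) q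
}.

Record is_norden (J g : matrix_field) : Prop := {
  norden_almost_complex : is_almost_complex J;
  norden_metric : is_metric g;
  norden_anti : forall c q (v w : E), cod c q ->
    (v *m J c q) *m g c q *m (w *m J c q)^T = - (v *m g c q *m w^T)
}.

Definition closed_form (w : chart M -> vf -> E -> R) : Prop :=
  forall c W X Y, local_open c W -> smooth_on W X -> smooth_on W Y ->
  forall q, W q -> ext_d (w c) X Y q = 0.

(* D is meant to be the Levi-Civita connection of g; m is the dimension 2n *)
Definition is_W1 (J g : matrix_field) (D : connection) : Prop :=
  forall c W X Y Z, local_open c W ->
  smooth_on W X -> smooth_on W Y -> smooth_on W Z ->
  forall q, W q ->
  let th := lie_form (J c) (g c) (D c) in
  let JY := app (J c) Y in
  let JZ := app (J c) Z in
  F_tensor (J c) (g c) (D c) X Y Z q =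
  m%:R^-1 * (inner (g c) X Y q * th Z q + inner (g c) X JY q * th JZ q
             + inner (g c) X Z q * th Y q + inner (g c) X JZ q * th JY q).

Record is_conformal_kahler_norden (J g : matrix_field) (D : connection)
    : Prop := {
  conformal_kahler_norden : is_norden J g;
  conformal_kahler_levi_civita : is_levi_civita g D;
  conformal_kahler_W1 : is_W1 J g D;
  conformal_kahler_lie_closed :
    closed_form (fun c => lie_form (J c) (g c) (D c));
  conformal_kahler_lie_star_closed :
    closed_form (fun c => lie_form_star (J c) (g c) (D c))
}.

Definition is_lie_vector (J g : matrix_field) (D : connection)
    (Omega : vector_field) : Prop :=
  forall c W X, local_open c W -> smooth_on W X ->
  forall q, W q -> lie_form (J c) (g c) (D c) X q = inner (g c) X (Omega c) q.

Definition pluriharmonic (J : matrix_field) (u : M -> R) : Prop :=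
  closed_form (fun c X => along (app (J c) X) (u \o @param R m M c)).

Definition conformal_metric (u : M -> R) (g : matrix_field) : matrix_field :=
  fun c q => expR (2 * u (@param R m M c q)) *: g c q.

End Manifold.

(* Main.v *)
(* Put phi = theta o J / 2n and let Dh be the connection
   Dh_X Y = D_X Y + phi(X) Y + phi(Y) X - g(X, Y) phi^#.  The W1 identity says
   exactly that Dh is complex; Dh is torsion free and Dh_X g = -2 phi(X) g.
   Under g -> e^(2u) g, Koszul's argument gives the conformal change of D,
   whence theta changes by 2n du o J and phi by -du: so Dh does not change.

   Let i act as J and read g, theta as the complex bilinear and linear forms
   they are the real parts of.  Then nabla' is
   Dh_X Y + (a + ib)(X) Y + w(Y) X - g(X, Y) w^#, where w is complex linear and
   all real 1-forms involved are closed: for a, b the curvature is unaffected,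
   and the rest is, up to w(X) Y, a complex conformal change.  So R' differs
   from the curvature of Dh by (psi1 - psi2)(S), with S(Jx, Jy) = -S(x, y) by
   closedness of w and w o J, and the Bochner tensor kills this difference.
   Both sides of the theorem are thus the Bochner tensor of the curvature of the
   same connection Dh, lowered with e^(2u) g and with g.

   Closedness of du is the symmetry of second derivatives (derive_comm), proved
   from the mean value theorem applied to the second difference. *)

Require Import Defs.
From HB Require Import structures.
From mathcomp Require Import all_boot all_order all_algebra.
From mathcomp Require Import all_classical all_reals all_analysis.
From mathcomp Require Import ring.

Set Implicit Arguments.
Unset Strict Implicit.
Unset Printing Implicit Defensive.
Import Order.TTheory GRing.Theory Num.Theory.
Import numFieldNormedType.Exports.
Local Open Scope classical_set_scope.
Local Open Scope ring_scope.

(** * Calculus of smooth functions *)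

Lemma open_near_eq (R : realType) (V : normedModType R) (T : Type) (W : set V)
    (f h : V -> T) q :
  open W -> {in W, f =1 h} -> W q -> {near q, f =1 h}.
Proof.
move=> oW fh Wq; near=> z; apply: fh; rewrite inE; near: z.
exact: open_nbhs_nbhs.
Unshelve. all: by end_near. Qed.

Lemma near_eq_continuous (R : realType) (V V' : normedModType R)
    (f h : V -> V') q :
  {near q, f =1 h} -> {for q, continuous f} -> {for q, continuous h}.
Proof.
move=> fh fc.
suff : h @ q --> h q by [].
rewrite -(nbhs_singleton fh).
exact: cvg_trans (near_eq_cvg fh) fc.
Qed.

(** A derivative at a point of the open set W sees only a neighbourhood inside W. In the sum,
    product, inverse and exponential rules this replaces a derivative by a formula valid on W
    only. *)
Lemma Ck_on_ext (R : realType) (V V' : normedModType R) k (W : set V)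
    (f h : V -> V') :
  open W -> {in W, f =1 h} -> Ck_on k W f -> Ck_on k W h.
Proof.
move=> oW; elim: k f h => [|k IH] f h fh [fc fd].
  split=> // q Wq.
  exact: near_eq_continuous (open_near_eq oW fh Wq) (fc q Wq).
split=> [q Wq|v].
  exact: near_eq_continuous (open_near_eq oW fh Wq) (fc q Wq).
have [fdv fk] := fd v; split=> [q Wq|].
  exact: near_eq_derivable (open_near_eq oW fh Wq) (fdv q Wq).
apply: (IH _ _ _ fk) => q /set_mem Wq.
exact: near_eq_derive (open_near_eq oW fh Wq).
Qed.

Lemma Ck_onW (R : realType) (V V' : normedModType R) k (W : set V)
    (f : V -> V') : Ck_on k.+1 W f -> Ck_on k W f.
Proof.
elim: k f => [|k IH] f [fc fd]; split=> // v.
by have [fdv fk] := fd v; split=> //; apply: IH.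
Qed.

Lemma Ck_on_cst (R : realType) (V V' : normedModType R) k (W : set V)
    (a : V') : Ck_on k W (fun=> a).
Proof.
elim: k a => [|k IH] a; split=> //; try by move=> *; exact: cst_continuous.
move=> v; split=> [q _|]; first exact: derivable_cst.
have -> : (fun q => 'D_v (fun=> a : V') q) = (fun=> 0 : V').
  by apply/funext => q; exact: derive_cst.
exact: IH.
Qed.

Lemma Ck_onD (R : realType) (V V' : normedModType R) k (W : set V)
    (f h : V -> V') :
  open W -> Ck_on k W f -> Ck_on k W h -> Ck_on k W (fun q => f q + h q).
Proof.
move=> oW; elim: k f h => [|k IH] f h [fc fd] [hc hd].
  by split=> // q Wq; apply: continuousD; [exact: fc|exact: hc].
split=> [q Wq|v]; first by apply: continuousD; [exact: fc|exact: hc].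
have [fdv fk] := fd v; have [hdv hk] := hd v; split=> [q Wq|].
  by apply: derivableD; [exact: fdv|exact: hdv].
apply: (Ck_on_ext oW _ (IH _ _ fk hk)) => q /set_mem Wq.
by rewrite -deriveD; [|exact: fdv|exact: hdv].
Qed.

(** The Leibniz formula contains f and h undifferentiated; [Ck_onW] lowers their order to that of
    the induction hypothesis. *)
Lemma Ck_onM (R : realType) (V : normedModType R) k (W : set V)
    (f h : V -> R) :
  open W -> Ck_on k W f -> Ck_on k W h -> Ck_on k W (fun q => f q * h q).
Proof.
move=> oW; elim: k f h => [|k IH] f h Cf Ch; have [fc fd] := Cf;
    have [hc hd] := Ch.
  by split=> // q Wq; apply: continuousM; [exact: fc|exact: hc].
split=> [q Wq|v]; first by apply: continuousM; [exact: fc|exact: hc].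
have [fdv fk] := fd v; have [hdv hk] := hd v; split=> [q Wq|].
  by apply: derivableM; [exact: fdv|exact: hdv].
apply: (Ck_on_ext oW _ (Ck_onD oW (IH _ _ (Ck_onW Cf) hk)
  (IH _ _ (Ck_onW Ch) fk))) => q /set_mem Wq.
by rewrite (deriveM (fdv q Wq) (hdv q Wq)).
Qed.

Lemma Ck_onV (R : realType) (V : normedModType R) k (W : set V)
    (f : V -> R) :
  open W -> (forall q, W q -> f q != 0) ->
  Ck_on k W f -> Ck_on k W (fun q => (f q)^-1).
Proof.
move=> oW f0; elim: k => [|k IH] Cf; have [fc fd] := Cf.
  by split=> // q Wq; apply: continuousV; [exact: f0|exact: fc].
split=> [q Wq|v]; first by apply: continuousV; [exact: f0|exact: fc].
have [fdv fk] := fd v; split=> [q Wq|].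
  by apply: derivableV; [exact: f0|exact: fdv].
have CV := IH (Ck_onW Cf).
have CN : Ck_on k W (fun=> -1 : R) by exact: Ck_on_cst.
have CD := Ck_onM oW (Ck_onM oW CN fk) (Ck_onM oW CV CV).
apply: (Ck_on_ext oW _ CD) => q /set_mem Wq.
rewrite deriveV; [|exact: f0|exact: fdv].
by rewrite -[RHS]/(_ * _) mulN1r mulNr mulrC expr2 invfM mulNr.
Qed.

(** Chain rule without Frechet differentiability of f: for the function t |-> f (t v + q) of one
    real variable derivability and differentiability coincide, and the one-variable chain rule
    applies. *)
Lemma is_derive_comp1 (R : realType) (V : normedModType R) (f : V -> R)
    (h : R -> R) q v (d : R) :
  derivable f q v -> is_derive (f q) 1 h d ->
  is_derive q v (h \o f) (d * 'D_v f q).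
Proof.
move=> fd hd.
have fd1 := (derivable1P f q v).1 fd.
have hd1 : derivable h (f (0 *: v + q)) 1.
  by rewrite scale0r add0r; exact: ex_derive.
have cd : derivable (h \o f) q v.
  apply/derivable1P; apply/derivable1_diffP.
  have := differentiable_comp (f := fun t : R => f (t *: v + q)) (g := h)
    ((derivable1_diffP _ _).1 fd1) ((derivable1_diffP _ _).1 hd1).
  exact.
apply: DeriveDef => //.
have D1 (k : V -> R) : 'D_v k q = derive1 (fun t : R => k (t *: v + q)) 0.
  rewrite derive1E /derive.
  set g1 := fun h0 => _; set g2 := fun h0 => _.
  suff -> : g1 = g2 by [].
  by rewrite funeqE /g1 /g2 => t /=; rewrite addr0 scale0r add0r [_%:A]mulr1.
rewrite !D1 (derive1_comp (g := h) fd1 hd1) scale0r add0r derive1E.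
by rewrite (@derive_val _ _ _ _ _ _ _ hd).
Qed.

Lemma Ck_on_expR (R : realType) (V : normedModType R) k (W : set V)
    (f : V -> R) :
  open W -> Ck_on k W f -> Ck_on k W (fun q => expR (f q)).
Proof.
move=> oW; elim: k => [|k IH] Cf; have [fc fd] := Cf.
  split=> // q Wq; apply: (continuous_comp (fc q Wq)).
  exact: continuous_expR.
split=> [q Wq|v].
  apply: (continuous_comp (fc q Wq)); exact: continuous_expR.
have [fdv fk] := fd v.
have E q : W q -> is_derive q v (expR \o f) (expR (f q) * 'D_v f q).
  by move=> Wq; apply: is_derive_comp1; exact: fdv.
split=> [q Wq|]; first by have [] := E q Wq.
apply: (Ck_on_ext oW _ (Ck_onM oW (IH (Ck_onW Cf)) fk)) => q /set_mem Wq.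
by have [_ <-] := E q Wq.
Qed.

Lemma continuous_mxP (R : realType) (V : normedModType R) a b
    (f : V -> 'M[R]_(a, b)) q :
  {for q, continuous f} <-> forall i j, {for q, continuous (fun x => f x i j)}.
Proof.
split=> [fc i j|fc].
  exact: continuous_comp fc (@matrix_normedtype.coord_continuous _ _ _ i j _).
apply/cvgrPdist_le => /= e e0; near=> x.
rewrite /Num.Def.normr/= mx_normrE (bigmax_le _ (ltW e0))//= => i _.
rewrite !mxE/=.
move: i; near: x; apply: filter_forall => /= i.
exact: ((cvgrPdist_le _ _).1 (fc i.1 i.2)).
Unshelve. all: by end_near. Qed.

Lemma Ck_on_mxP (R : realType) (V : normedModType R) k (W : set V) a b
    (f : V -> 'M[R]_(a, b)) : open W ->
  Ck_on k W f <-> forall i j, Ck_on k W (fun x => f x i j).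
Proof.
move=> oW; elim: k f => [|k IH] f; split.
- by move=> [fc _] i j; split=> // q Wq; have /continuous_mxP := fc q Wq; exact.
- move=> Cf; split=> // q Wq; apply/continuous_mxP => i j.
  by have [fc _] := Cf i j; exact: fc.
- move=> [fc fd] i j; split=> [q Wq|v].
    by have /continuous_mxP := fc q Wq; exact.
  have [fdv /IH fk] := fd v; split=> [q Wq|].
    by have /derivable_mxP := fdv q Wq; exact.
  apply: (Ck_on_ext oW _ (fk i j)) => q /set_mem Wq /=.
  by rewrite derive_mx ?mxE//; exact: fdv.
- move=> Cf; split=> [q Wq|v].
    by apply/continuous_mxP => i j; have [fc _] := Cf i j; exact: fc.
  have fdv q : W q -> derivable f q v.
    by move=> Wq; apply/derivable_mxP => i j; apply: (((Cf i j).2 v).1 q Wq).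
  split=> //; apply/IH => i j.
  apply: (Ck_on_ext oW _ (((Cf i j).2 v).2)) => q /set_mem Wq /=.
  by rewrite derive_mx ?mxE//; exact: fdv.
Qed.

Lemma Ck_on_sub (R : realType) (V V' : normedModType R) k (W W' : set V)
    (f : V -> V') : W' `<=` W -> Ck_on k W f -> Ck_on k W' f.
Proof.
move=> WW; elim: k f => [|k IH] f [fc fd].
  by split=> // q /WW; exact: fc.
split=> [q /WW|v]; first exact: fc.
by have [fdv fk] := fd v; split=> [q /WW|]; [exact: fdv|exact: IH].
Qed.

Lemma smooth_on_sub (R : realType) (V V' : normedModType R) (W W' : set V)
    (f : V -> V') : W' `<=` W -> smooth_on W f -> smooth_on W' f.
Proof. by move=> WW sf k; exact: Ck_on_sub WW (sf k). Qed.

Section SmoothCalculus.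
Variables (R : realType) (V : normedModType R) (W : set V).
Hypothesis oW : open W.

Lemma smooth_on_ext (V' : normedModType R) (f h : V -> V') :
  (forall q, W q -> f q = h q) -> smooth_on W f -> smooth_on W h.
Proof.
move=> fh sf k; apply: (Ck_on_ext oW _ (sf k)) => q /set_mem; exact: fh.
Qed.

Lemma smooth_on_cst (V' : normedModType R) (a : V') : smooth_on W (fun=> a).
Proof. by move=> k; exact: Ck_on_cst. Qed.

Lemma smooth_onD (V' : normedModType R) (f h : V -> V') :
  smooth_on W f -> smooth_on W h -> smooth_on W (fun q => f q + h q).
Proof. by move=> sf sh k; exact: Ck_onD. Qed.

Lemma smooth_onM (f h : V -> R) :
  smooth_on W f -> smooth_on W h -> smooth_on W (fun q => f q * h q).
Proof. by move=> sf sh k; exact: Ck_onM. Qed.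

Lemma smooth_onV (f : V -> R) : (forall q, W q -> f q != 0) ->
  smooth_on W f -> smooth_on W (fun q => (f q)^-1).
Proof. by move=> f0 sf k; exact: Ck_onV. Qed.

Lemma smooth_on_expR (f : V -> R) :
  smooth_on W f -> smooth_on W (fun q => expR (f q)).
Proof. by move=> sf k; exact: Ck_on_expR. Qed.

Lemma smooth_on_mxP a b (f : V -> 'M[R]_(a, b)) :
  smooth_on W f <-> forall i j, smooth_on W (fun x => f x i j).
Proof.
split=> [sf i j k|sf k]; first by have /(Ck_on_mxP _ _ oW) := sf k; exact.
by apply/(Ck_on_mxP _ _ oW) => i j; exact: sf.
Qed.

Lemma smooth_on_sum (V' : normedModType R) (I : Type) (r : seq I) (P : pred I)
    (f : I -> V -> V') : (forall i, P i -> smooth_on W (f i)) ->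
  smooth_on W (fun q => \sum_(i <- r | P i) f i q).
Proof.
move=> sf; elim: r => [|i r IH].
  by under eq_fun do rewrite big_nil; exact: smooth_on_cst.
under eq_fun do rewrite big_cons.
case Pi: (P i) => //; apply: smooth_onD => //; exact: sf.
Qed.

Lemma smooth_on_prod (I : Type) (r : seq I) (P : pred I)
    (f : I -> V -> R) : (forall i, P i -> smooth_on W (f i)) ->
  smooth_on W (fun q => \prod_(i <- r | P i) f i q).
Proof.
move=> sf; elim: r => [|i r IH].
  by under eq_fun do rewrite big_nil; exact: smooth_on_cst.
under eq_fun do rewrite big_cons.
case Pi: (P i) => //; apply: smooth_onM => //; exact: sf.
Qed.

Lemma smooth_onZ a b (f : V -> R) (h : V -> 'M[R]_(a, b)) :
  smooth_on W f -> smooth_on W h -> smooth_on W (fun q => f q *: h q).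
Proof.
move=> sf /smooth_on_mxP sh; apply/smooth_on_mxP => i j.
by under eq_fun do rewrite mxE; exact: smooth_onM.
Qed.

Lemma smooth_on_scale a b (k : R) (h : V -> 'M[R]_(a, b)) :
  smooth_on W h -> smooth_on W (fun q => k *: h q).
Proof. by apply: smooth_onZ; exact: smooth_on_cst. Qed.

Lemma smooth_onN a b (h : V -> 'M[R]_(a, b)) :
  smooth_on W h -> smooth_on W (fun q => - h q).
Proof.
by move=> sh; under eq_fun do rewrite -scaleN1r; exact: smooth_on_scale.
Qed.

Lemma smooth_onB a b (f h : V -> 'M[R]_(a, b)) :
  smooth_on W f -> smooth_on W h -> smooth_on W (fun q => f q - h q).
Proof. by move=> sf sh; apply: smooth_onD => //; exact: smooth_onN. Qed.

Lemma smooth_on_mulmx a b c (f : V -> 'M[R]_(a, b)) (h : V -> 'M[R]_(b, c)) :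
  smooth_on W f -> smooth_on W h -> smooth_on W (fun q => f q *m h q).
Proof.
move=> /smooth_on_mxP sf /smooth_on_mxP sh; apply/smooth_on_mxP => i j.
under eq_fun do rewrite mxE.
by apply: smooth_on_sum => k _; exact: smooth_onM.
Qed.

Lemma smooth_on_trmx a b (f : V -> 'M[R]_(a, b)) :
  smooth_on W f -> smooth_on W (fun q => (f q)^T).
Proof.
move=> /smooth_on_mxP sf; apply/smooth_on_mxP => i j.
by under eq_fun do rewrite mxE; exact: sf.
Qed.

Lemma smooth_on_det a (f : V -> 'M[R]_a) :
  smooth_on W f -> smooth_on W (fun q => \det (f q)).
Proof.
move=> /smooth_on_mxP sf; apply: smooth_on_sum => s _.
apply: smooth_onM; first exact: smooth_on_cst.
by apply: smooth_on_prod => i _; exact: sf.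
Qed.

(** By the adjugate formula the inverse is rational in the entries. The formula describes [invmx]
    only at invertible matrices, hence the passage through [smooth_on_ext]. *)
Lemma smooth_on_invmx a (f : V -> 'M[R]_a) :
  (forall q, W q -> f q \in unitmx) ->
  smooth_on W f -> smooth_on W (fun q => invmx (f q)).
Proof.
move=> fU sf.
apply: (@smooth_on_ext _ (fun q => (\det (f q))^-1 *: \adj (f q))).
  by move=> q /fU U; rewrite /invmx U.
apply: smooth_onZ.
  apply: smooth_onV; last exact: smooth_on_det.
  by move=> q /fU; rewrite unitmxE unitfE.
apply/smooth_on_mxP => i j; under eq_fun do rewrite mxE /cofactor.
apply: smooth_onM; first exact: smooth_on_cst.
apply: smooth_on_det; apply/smooth_on_mxP => k l.
under eq_fun do rewrite !mxE; move: sf => /smooth_on_mxP sf; exact: sf.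
Qed.

Lemma smooth_on_derivable (V' : normedModType R) (f : V -> V') q v :
  smooth_on W f -> W q -> derivable f q v.
Proof. by move=> /(_ 1%N)[_ /(_ v)[+ _]]; exact. Qed.

Lemma smooth_on_derive (V' : normedModType R) (f : V -> V') v :
  smooth_on W f -> smooth_on W (fun q => 'D_v f q).
Proof. by move=> sf k; have [_ /(_ v)[_]] := sf k.+1. Qed.

Lemma smooth_on_continuous (V' : normedModType R) (f : V -> V') q :
  smooth_on W f -> W q -> {for q, continuous f}.
Proof. by move=> /(_ 0%N)[+ _] => /(_ q). Qed.

(** * Symmetry of second derivatives *)

Lemma line_MVT (f : V -> R) q v (t : R) : 0 < t ->
  (forall s, 0 <= s <= t -> derivable f (s *: v + q) v) ->
  exists2 s, 0 <= s <= t & f (t *: v + q) - f q = 'D_v f (s *: v + q) * t.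
Proof.
move=> t0 fd; pose h s := f (s *: v + q).
have hd s : 0 <= s <= t -> is_derive s 1 h ('D_v f (s *: v + q)).
  move=> st; have E : (fun r : R => r^-1 *: (h (r *: 1 + s) - h s)) =
      (fun r : R => r^-1 *: (f (r *: v + (s *: v + q)) - f (s *: v + q))).
    by apply/funext => r; rewrite /h [_%:A]mulr1 scalerDl addrA.
  split; first by rewrite /derivable E; exact: fd.
  by rewrite /derive E.
have hc : {within `[0, t], continuous h}.
  apply: derivable_within_continuous => s /=; rewrite in_itv/= => st.
  by have [] := hd s st.
have [|s] := @MVT R h (fun s => 'D_v f (s *: v + q)) _ _ t0 _ hc.
  by move=> s; rewrite in_itv/= => /andP[s0 st]; apply: hd; rewrite !ltW.
rewrite in_itv/= => /andP[s0 st]; rewrite /h scale0r add0r subr0 => E.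
by exists s => //; rewrite !ltW.
Qed.

(** The mean value theorem is applied first along v, to the increment [h] of f in direction w, and
    then along w, to the derivative of f in direction v. *)
Lemma second_difference (f : V -> R) q v w (t : R) : smooth_on W f -> 0 < t ->
  (forall r s, 0 <= r <= t -> 0 <= s <= t -> W (r *: v + (s *: w + q))) ->
  exists r s, [/\ 0 <= r <= t, 0 <= s <= t &
    f (t *: v + (t *: w + q)) - f (t *: w + q) - f (t *: v + q) + f q =
    'D_w (fun z => 'D_v f z) (r *: v + (s *: w + q)) * t ^+ 2].
Proof.
move=> sf t0 Wb; have tt : 0 <= t <= t by rewrite lexx ltW.
have zt : 0 <= (0 : R) <= t by rewrite lexx ltW.
pose h z := f (t *: w + z) - f z.
have sh z : W (t *: w + z) -> W z ->
    is_derive z v h ('D_v f (t *: w + z) - 'D_v f z).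
  move=> W1 W2.
  pose k z := f (t *: w + z).
  have E0 : (fun r : R => r^-1 *: (k (r *: v + z) - k z)) =
      (fun r : R => r^-1 *: (f (r *: v + (t *: w + z)) - f (t *: w + z))).
    by apply/funext => r; rewrite /k addrCA.
  have D1 : derivable k z v.
    by rewrite /derivable E0; exact: smooth_on_derivable sf W1.
  have E1 : 'D_v k z = 'D_v f (t *: w + z) by rewrite /derive E0.
  have D2 := smooth_on_derivable (v := v) sf W2.
  split; first exact: (@derivableB _ _ _ k f).
  by rewrite -E1; exact: (@deriveB _ _ _ k f).
have Wq s r : 0 <= r <= t -> 0 <= s <= t -> W (s *: w + (r *: v + q)).
  by move=> rt st; rewrite addrCA; exact: Wb.
have Wr r : 0 <= r <= t -> W (r *: v + q).
  by move=> rt; have := Wq 0 r rt zt; rewrite scale0r add0r.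
have [|r rt E] := @line_MVT h q v t t0.
  by move=> s st; have [] := sh (s *: v + q) (Wq _ _ st tt) (Wr _ st).
have [|s st E2] := @line_MVT (fun z => 'D_v f z) (r *: v + q) w t t0.
  move=> s st; apply: smooth_on_derivable; last exact: Wq.
  exact: smooth_on_derive.
exists r, s; split=> //.
have -> : f (t *: v + (t *: w + q)) - f (t *: w + q) - f (t *: v + q) + f q =
    h (t *: v + q) - h q.
  by rewrite /h (addrCA (t *: w) (t *: v)); ring.
rewrite E; have [_ ->] := sh (r *: v + q) (Wq _ _ rt tt) (Wr _ rt).
by rewrite E2 (addrCA (s *: w)) expr2 mulrA.
Qed.

(** The second difference over the parallelogram at q with sides t v and t w is symmetric in v and
    w. So the two mixed derivatives coincide when taken at two suitable points near q, and
    continuity brings each within e / 2 of its value at q. *)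
Lemma derive_comm (f : V -> R) q v w : smooth_on W f -> W q ->
  'D_w (fun z => 'D_v f z) q = 'D_v (fun z => 'D_w f z) q.
Proof.
move=> sf Wq.
set a := LHS; set b := RHS.
apply/eqP; rewrite -subr_eq0 -normr_le0; apply/ler_addgt0Pl => e e0.
rewrite addr0.
have e20 : 0 < e / 2 by rewrite divr_gt0.
have ca : {for q, continuous (fun z => 'D_w (fun y => 'D_v f y) z)}.
  by apply: smooth_on_continuous Wq; do 2 apply: smooth_on_derive.
have cb : {for q, continuous (fun z => 'D_v (fun y => 'D_w f y) z)}.
  by apply: smooth_on_continuous Wq; do 2 apply: smooth_on_derive.
have nW : \forall z \near q, W z by exact: open_nbhs_nbhs.
have nA : \forall z \near q, `|a - 'D_w (fun y => 'D_v f y) z| <= e / 2.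
  exact: ((cvgrPdist_le _ _).1 ca).
have nB : \forall z \near q, `|b - 'D_v (fun y => 'D_w f y) z| <= e / 2.
  exact: ((cvgrPdist_le _ _).1 cb).
have nP : nbhs q (W `&` ([set z | `|a - 'D_w (fun y => 'D_v f y) z| <= e / 2]
    `&` [set z | `|b - 'D_v (fun y => 'D_w f y) z| <= e / 2])).
  by apply: filterI nW _; exact: filterI nA nB.
have /nbhs_ballP[d /= d0 dP] := nP.
(* For r, s in [0, t] the point r v + s w + q is at distance at most t K = d / 2 from q; the summand
   1 keeps K positive when v = w = 0. *)
pose K := `|v| + `|w| + 1.
have K0 : 0 < K by rewrite ltr_wpDl// addr_ge0.
pose t := d / 2 / K; have t0 : 0 < t by rewrite !divr_gt0.
have box r s : 0 <= r <= t -> 0 <= s <= t ->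
    ball q d (r *: v + (s *: w + q)).
  move=> /andP[r0 rt] /andP[s0 st]; rewrite -ball_normE /ball_/= addrA.
  rewrite opprD addrCA subrr addr0 normrN.
  rewrite (le_lt_trans (ler_normD _ _))// !normrZ !ger0_norm//.
  apply: (@le_lt_trans _ _ (t * `|v| + t * `|w|)).
    by rewrite lerD// ler_wpM2r.
  rewrite -mulrDr; apply: (@le_lt_trans _ _ (t * K)).
    by rewrite ler_wpM2l ?(ltW t0)// lerDl.
  by rewrite /t divfK ?gt_eqF// ltr_pdivrMr// ltr_pMr// ltr1n.
have box' r s : 0 <= r <= t -> 0 <= s <= t ->
    ball q d (r *: w + (s *: v + q)).
  by move=> rt st; rewrite addrCA; exact: box.
have [r [s [rt st E]]] := second_difference sf t0
  (fun r s rt st => proj1 (dP _ (box r s rt st))).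
have [r' [s' [rt' st' E']]] := second_difference sf t0
  (fun r s rt st => proj1 (dP _ (box' r s rt st))).
have [_ [Ba _]] := dP _ (box r s rt st).
have [_ [_ Bb]] := dP _ (box' r' s' rt' st').
have EE : 'D_w (fun z => 'D_v f z) (r *: v + (s *: w + q)) =
    'D_v (fun z => 'D_w f z) (r' *: w + (s' *: v + q)).
  have t2 : t ^+ 2 != 0 by rewrite expf_neq0// gt_eqF.
  apply: (mulIf t2); apply: etrans (etrans _ E'); first exact: esym E.
  by rewrite (addrCA (t *: w)); ring.
rewrite -(subrKA ('D_w (fun z => 'D_v f z) (r *: v + (s *: w + q)))).
apply: (le_trans (ler_normD _ _)); rewrite [leRHS](splitr e).
apply: lerD; first exact: Ba.
rewrite EE distrC; exact: Bb.
Qed.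

End SmoothCalculus.

(** * Bilinear forms and traces *)

Section BilinearForm.
Variables (R : realType) (m : nat).
Implicit Types (g A B J : 'M[R]_m) (v w : 'rV[R]_m).

(** [inner] at one point, which unfolds to it: identities between vector fields become identities
    between row vectors. *)
Definition bil A v w : R := (v *m A *m w^T) 0 0.

Lemma bilDl A v v' w : bil A (v + v') w = bil A v w + bil A v' w.
Proof. by rewrite /bil !mulmxDl mxE. Qed.

Lemma bilDr A v w w' : bil A v (w + w') = bil A v w + bil A v w'.
Proof. by rewrite /bil linearD mulmxDr mxE. Qed.

Lemma bilZl A k v w : bil A (k *: v) w = k * bil A v w.
Proof. by rewrite /bil -!scalemxAl mxE. Qed.

Lemma bilZr A k v w : bil A v (k *: w) = k * bil A v w.
Proof. by rewrite /bil linearZ -scalemxAr mxE. Qed.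

Lemma bilNl A v w : bil A (- v) w = - bil A v w.
Proof. by rewrite -scaleN1r bilZl mulN1r. Qed.

Lemma bilNr A v w : bil A v (- w) = - bil A v w.
Proof. by rewrite -scaleN1r bilZr mulN1r. Qed.

Lemma bilC A v w : A^T = A -> bil A v w = bil A w v.
Proof.
move=> As; rewrite /bil; transitivity ((w *m A *m v^T)^T 0 0).
  by rewrite !trmx_mul trmxK As mulmxA.
by rewrite mxE.
Qed.

Lemma bilZm A k v w : bil (k *: A) v w = k * bil A v w.
Proof. by rewrite /bil -scalemxAr -scalemxAl mxE. Qed.

Lemma bil_mulmxr A J v w : bil A v (w *m J) = bil (A *m J^T) v w.
Proof. by rewrite /bil trmx_mul !mulmxA. Qed.

Lemma bil_mulmxl A J v w : bil A (v *m J) w = bil (J *m A) v w.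
Proof. by rewrite /bil !mulmxA. Qed.

Lemma bil_delta A a b : bil A (delta_mx 0 a) (delta_mx 0 b) = A a b.
Proof. by rewrite /bil trmx_delta -rowE -colE !mxE. Qed.

Lemma bil_deltal A v a : bil A (delta_mx 0 a) v = (A *m v^T) a 0.
Proof. by rewrite /bil -mulmxA -rowE mxE. Qed.

Lemma bil_deltar A v a : bil A v (delta_mx 0 a) = (v *m A) 0 a.
Proof. by rewrite /bil trmx_delta -colE mxE. Qed.

Lemma bil_inj A v w : A \in unitmx ->
  (forall a, bil A v (delta_mx 0 a) = bil A w (delta_mx 0 a)) -> v = w.
Proof.
move=> AU vw.
suff : v *m A = w *m A by move/(can_inj (mulmxK AU)).
apply/rowP => a; have := vw a.
by rewrite /bil !trmx_delta -!colE !mxE.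
Qed.

Lemma bil_outer A B (p p' v w : 'rV[R]_m) :
  bil (A *m p^T *m p' *m B) v w = bil A v p * bil B p' w.
Proof.
rewrite /bil !mulmxA -(mulmxA _ p' B) -(mulmxA _ (p' *m B) w^T).
by rewrite mxE big_ord1.
Qed.

Lemma bil_ext A B : (forall v w, bil A v w = bil B v w) -> A = B.
Proof. by move=> AB; apply/matrixP => a b; rewrite -!bil_delta AB. Qed.

Lemma bilDm A B v w : bil (A + B) v w = bil A v w + bil B v w.
Proof. by rewrite /bil mulmxDr mulmxDl mxE. Qed.

Lemma bilNm A v w : bil (- A) v w = - bil A v w.
Proof. by rewrite -scaleN1r bilZm mulN1r. Qed.

Lemma bil_suml A (I : finType) (f : I -> 'rV[R]_m) w :
  bil A (\sum_i f i) w = \sum_i bil A (f i) w.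
Proof. by rewrite /bil !mulmx_suml summxE. Qed.

Definition contract g (F : 'I_m -> 'I_m -> R) : R :=
  \sum_(a < m) \sum_(b < m) invmx g a b * F a b.

Lemma contractD g F G :
  contract g (fun a b => F a b + G a b) = contract g F + contract g G.
Proof.
rewrite /contract -big_split; apply: eq_bigr => a _; rewrite -big_split.
by apply: eq_bigr => b _; rewrite mulrDr.
Qed.

Lemma contractZ g k F : contract g (fun a b => k * F a b) = k * contract g F.
Proof.
rewrite /contract mulr_sumr; apply: eq_bigr => a _; rewrite mulr_sumr.
by apply: eq_bigr => b _; rewrite mulrCA.
Qed.

Lemma contractN g F : contract g (fun a b => - F a b) = - contract g F.
Proof.
rewrite -mulN1r -contractZ; congr contract.
by apply/funext => a; apply/funext => b; rewrite mulN1r.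
Qed.

Lemma eq_contract g F G :
  (forall a b, F a b = G a b) -> contract g F = contract g G.
Proof.
by move=> FG; congr contract; apply/funext => a; apply/funext => b.
Qed.

Definition gtr g A : R := contract g (fun a b => A a b).

Lemma contract_delta g A :
  contract g (fun a b => bil A (delta_mx 0 a) (delta_mx 0 b)) = gtr g A.
Proof. by apply: eq_contract => a b; rewrite bil_delta. Qed.

Lemma gtrE A B : gtr A B = \tr (invmx A *m B^T).
Proof.
by rewrite /mxtrace; apply: eq_bigr => a _; rewrite mxE; apply: eq_bigr => b _;
  rewrite mxE.
Qed.

(* J is skew for the positive definite 1 + J J^T. *)
Lemma mxtrace_complex_structure J : J *m J = - 1%:M -> \tr J = 0.
Proof.
move=> JJ; pose H := 1%:M + J *m J^T.
(* A kernel vector v of H satisfies |v|^2 + |v J|^2 = v H v^T = 0. *)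
have HU : H \in unitmx.
  rewrite -row_free_unit -kermx_eq0; apply/eqP/row_matrixP => i; rewrite row0.
  set v := row i (kermx H).
  have vH : v *m H = 0 by rewrite /v -row_mul mulmx_ker row0.
  have sq k (x : 'rV[R]_k) : (x *m x^T) 0 0 = \sum_j x 0 j ^+ 2.
    by rewrite mxE; apply: eq_bigr => j _; rewrite mxE expr2.
  have : (v *m v^T) 0 0 + ((v *m J) *m (v *m J)^T) 0 0 = 0.
    have -> : (v *m v^T) 0 0 + ((v *m J) *m (v *m J)^T) 0 0 =
        (v *m H *m v^T) 0 0.
      by rewrite /H mulmxDr mulmxDl mulmx1 trmx_mul !mulmxA [RHS]mxE.
    by rewrite vH mul0mx mxE.
  rewrite !sq => /eqP; rewrite paddr_eq0 ?sumr_ge0//; last first.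
  - by move=> j _; exact: sqr_ge0.
  - by move=> j _; exact: sqr_ge0.
  move=> /andP[/eqP v0 _]; apply/rowP => j; rewrite [RHS]mxE.
  apply/eqP; rewrite -sqrf_eq0; apply/eqP.
  by apply: (psumr_eq0P _ v0) => // k _; exact: sqr_ge0.
have HJ : J *m H = - (H *m J^T).
  rewrite /H mulmxDr mulmxDl mulmx1 mul1mx !mulmxA JJ mulNmx mul1mx.
  by rewrite -[_ *m J^T *m _]mulmxA -trmx_mul JJ linearN /= trmx1 mulmxN mulmx1
    opprD opprK addrC.
have trJ : \tr J = - \tr J.
  rewrite -[X in \tr X = _](mulmxK HU) HJ mulNmx linearN /=.
  by rewrite -mulmxA mxtrace_mulC -mulmxA mulVmx// mulmx1 mxtrace_tr.
have : \tr J *+ 2 == 0 by rewrite mulr2n {1}trJ addNr.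
by rewrite mulrn_eq0 => /eqP.
Qed.

Section Metric.
Variables (g J : 'M[R]_m).
Hypotheses (gU : g \in unitmx) (gs : g^T = g) (JJ : J *m J = - 1%:M).
Hypothesis gJ : J *m g *m J^T = - g.

Let invmx_sym : (invmx g)^T = invmx g.
Proof. by rewrite trmx_inv gs. Qed.

(** A Norden metric makes J self-adjoint, so J moves across g without a sign. *)
Lemma mul_norden : J *m g = g *m J^T.
Proof.
have /(congr1 (mulmx J)) := gJ.
rewrite !mulmxA JJ mulNmx mul1mx mulNmx mulmxN => /eqP.
by rewrite eqr_opp => /eqP.
Qed.

Lemma bil_app v w : bil g (v *m J) w = bil g v (w *m J).
Proof. by rewrite bil_mulmxl bil_mulmxr mul_norden. Qed.

Lemma app_app v : v *m J *m J = - v.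
Proof. by rewrite -mulmxA JJ mulmxN mulmx1. Qed.

(** Contracting one slot of A with one slot of B composes them through the inverse of g. If A or B
    is g itself, the other form comes back. *)
Lemma contract_mul A B y z :
  contract g (fun a b => bil A (delta_mx 0 a) z * bil B y (delta_mx 0 b)) =
  bil (B *m invmx g *m A) y z.
Proof.
transitivity ((y *m B *m (invmx g)^T *m (A *m z^T)) 0 0); last first.
  by rewrite invmx_sym /bil !mulmxA.
rewrite mxE; apply: eq_bigr => a _; rewrite mxE mulr_suml.
apply: eq_bigr => b _; rewrite bil_deltal bil_deltar [(_^T) _ _]mxE.
by ring.
Qed.

Lemma gtr_self : gtr g g = m%:R.
Proof. by rewrite gtrE gs mulVmx// mxtrace1. Qed.

(** Raising an index of g(., J .) gives J back, and J has trace zero. *)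
Lemma gtr_assoc : gtr g (g *m J^T) = 0.
Proof.
rewrite gtrE trmx_mul trmxK gs mul_norden mulmxA mulVmx// mul1mx mxtrace_tr.
exact: mxtrace_complex_structure.
Qed.

End Metric.
End BilinearForm.

(** * The Bochner tensor *)

Section Bochner.
Variables (R : realType) (n : nat).
Local Notation m := (2 * n)%N.
Local Notation E := 'rV[R]_m.
Local Notation vf := (E -> E).
Local Notation fn := (E -> R).
Variables (J : E -> 'M[R]_m).

(** A constant matrix suffices for S, because the Bochner tensor at q uses only values at q. *)
Definition tensor2 (S : 'M[R]_m) : vf -> vf -> fn :=
  fun X Y q => bil S (X q) (Y q).

Definition psi12 (g : E -> 'M[R]_m) (S : 'M[R]_m) (X Y Z V : vf) : fn :=
  fun q => psi1 g (tensor2 S) X Y Z V q - psi2 J g (tensor2 S) X Y Z V q.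

(** * Kernel of the Bochner tensor *)

Section Kernel.
Variables (g : E -> 'M[R]_m) (q : E) (S : 'M[R]_m).
Hypotheses (gU : g q \in unitmx) (gs : (g q)^T = g q).
Hypotheses (JJ : J q *m J q = - 1%:M) (gJ : J q *m g q *m (J q)^T = - g q).
Hypothesis SJ : J q *m S *m (J q)^T = - S.

Let t := gtr (g q) S.
Let t' := gtr (g q) (S *m (J q)^T).

Let bSJ v w : bil S (v *m J q) (w *m J q) = - bil S v w.
Proof. by rewrite bil_mulmxr bil_mulmxl mulmxA SJ -scaleN1r bilZm mulN1r. Qed.

(** Four of the eight terms contract to -S, two of them through J^2 = -1 and S(Jx, Jy) = -S(x, y).
    The trace of g is m, and that of g(., J .) vanishes. *)
Lemma ricci_psi12 Y Z :
  ricci g (psi12 g S) Y Z q =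
  t * bil (g q) (Y q) (Z q) + (m%:R - 4) * bil S (Y q) (Z q)
  - t' * bil (g q) (Y q) (Z q *m J q).
Proof.
rewrite /ricci /trace -/(contract _ _).
pose e a : E := delta_mx 0 a.
transitivity (contract (g q) (fun a b =>
  bil (g q) (Y q) (Z q) * bil S (e a) (e b)
  + - (bil (g q) (e a) (Z q) * bil S (Y q) (e b))
  + bil S (Y q) (Z q) * bil (g q) (e a) (e b)
  + - (bil S (e a) (Z q) * bil (g q) (Y q) (e b))
  + - (bil (g q) (Y q) (Z q *m J q) * bil (S *m (J q)^T) (e a) (e b))
  + bil (g q) (e a) (Z q *m J q) * bil (S *m (J q)^T) (Y q) (e b)
  + - (bil S (Y q) (Z q *m J q) * bil (g q *m (J q)^T) (e a) (e b))
  + bil S (e a) (Z q *m J q) * bil (g q *m (J q)^T) (Y q) (e b))).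
  apply: eq_contract => a b; rewrite -!bil_mulmxr.
  rewrite /psi12 /psi1 /psi2 /tensor2 /frame /app /inner -!/(bil _ _ _).
  rewrite -/(e a) -/(e b).
  by ring.
rewrite !contractD !contractN !contractZ.
rewrite !contract_delta (gtr_self gU gs) (gtr_assoc gU gs JJ gJ) -/t -/t'.
rewrite !contract_mul// -(mul_norden JJ gJ) !mulmxKV// !mulmxV//.
rewrite mulmxK// mul1mx -bil_mulmxr (app_app JJ) bilNr -bil_mulmxl bSJ.
by ring.
Qed.

Lemma scal_psi12 : scal g (psi12 g S) q = (2 * m%:R - 4) * t.
Proof.
rewrite /scal /trace -/(contract _ _).
transitivity (contract (g q) (fun a b =>
    t * bil (g q) (delta_mx 0 a) (delta_mx 0 b)
  + (m%:R - 4) * bil S (delta_mx 0 a) (delta_mx 0 b)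
  + - (t' * bil (g q *m (J q)^T) (delta_mx 0 a) (delta_mx 0 b)))).
  by apply: eq_contract => a b; rewrite ricci_psi12 /frame -bil_mulmxr.
rewrite !contractD !contractN !contractZ !contract_delta.
rewrite (gtr_self gU gs) (gtr_assoc gU gs JJ gJ) -/t -/t'.
by ring.
Qed.

Lemma scal_star_psi12 : scal_star J g (psi12 g S) q = (2 * m%:R - 4) * t'.
Proof.
rewrite /scal_star /trace -/(contract _ _).
transitivity (contract (g q) (fun a b =>
    t * bil (g q *m (J q)^T) (delta_mx 0 a) (delta_mx 0 b)
  + (m%:R - 4) * bil (S *m (J q)^T) (delta_mx 0 a) (delta_mx 0 b)
  + t' * bil (g q) (delta_mx 0 a) (delta_mx 0 b))).
  apply: eq_contract => a b; rewrite ricci_psi12 /frame /app -!bil_mulmxr.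
  by rewrite (app_app JJ) bilNr mulrN opprK.
rewrite !contractD !contractZ !contract_delta.
rewrite (gtr_self gU gs) (gtr_assoc gU gs JJ gJ) -/t -/t'.
by ring.
Qed.

(** With m = 2n the Ricci tensor is 2 (n - 2) S + t g - t' g(., J .). The psi term of the Bochner
    tensor cancels the given tensor and leaves -(t (pi1 - pi2) + t' pi3) / (n - 2), which the
    scalars 4 (n - 1) t and 4 (n - 1) t' cancel in turn. The bound on n makes the denominators
    nonzero. *)
Lemma bochner_psi12 X Y Z V : (2 < n)%N ->
  bochner n J g (psi12 g S) X Y Z V q = 0.
Proof.
move=> n2; rewrite /bochner scal_psi12 scal_star_psi12.
rewrite {1}/psi12 /pi1 /pi2 /pi3 /psi1 /psi2 /assoc_metric !ricci_psi12.
rewrite /tensor2 /inner /app -!/(bil _ _ _) !(app_app JJ) !bilNr.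
rewrite natrM.
have n1 : n%:R - 1 != 0 :> R.
  by rewrite subr_eq0 (eqr_nat R n 1) gtn_eqF// (ltn_trans _ n2).
have n20 : n%:R - 2 != 0 :> R by rewrite subr_eq0 (eqr_nat R n 2) gtn_eqF.
by field; rewrite n1 n20.
Qed.

End Kernel.

(** * Linearity and conformal weight of the Bochner tensor *)

Section Linearity.
Variables (g : E -> 'M[R]_m) (q : E) (P : vf -> Prop).
Hypotheses (Pframe : forall a, P (frame a)) (PJ : forall X, P X -> P (app J X)).

(** P will be smoothness, since curvatures are compared on smooth fields only. The traces insert
    coordinate fields and their images under J, which satisfy P as well. *)
Lemma bochnerB (L L1 L2 : vf -> vf -> vf -> vf -> fn) X Y Z V :
  (forall X Y Z V, P X -> P Y -> P Z -> P V ->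
     L X Y Z V q = L1 X Y Z V q - L2 X Y Z V q) ->
  P X -> P Y -> P Z -> P V ->
  bochner n J g L X Y Z V q =
  bochner n J g L1 X Y Z V q - bochner n J g L2 X Y Z V q.
Proof.
move=> LE PX PY PZ PV.
have ricE A B : P A -> P B ->
    ricci g L A B q = ricci g L1 A B q - ricci g L2 A B q.
  move=> PA PB; rewrite /ricci /trace -!/(contract _ _).
  by rewrite -contractN -contractD; apply: eq_contract => a b; exact: LE.
have scE : scal g L q = scal g L1 q - scal g L2 q.
  rewrite /scal /trace -!/(contract _ _).
  by rewrite -contractN -contractD; apply: eq_contract => a b; exact: ricE.
have scsE : scal_star J g L q = scal_star J g L1 q - scal_star J g L2 q.
  rewrite /scal_star /trace -!/(contract _ _).
  rewrite -contractN -contractD; apply: eq_contract => a b.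
  by apply: ricE => //; exact: PJ.
rewrite /bochner scE scsE LE// /psi1 /psi2 !ricE//; try exact: PJ.
by ring.
Qed.

(** The inverse metric contributes c^-1 to every trace: the Ricci tensor is unchanged and both
    scalars scale by c^-1. Its images under psi1 and psi2 scale by c, the pi tensors by c^2, so
    every term has weight c. *)
Lemma bochner_conformal (gb : E -> 'M[R]_m) (c : R)
    (L Lb : vf -> vf -> vf -> vf -> fn) X Y Z V :
  g q \in unitmx -> c != 0 -> gb q = c *: g q ->
  (forall X Y Z V, P X -> P Y -> P Z -> P V ->
     Lb X Y Z V q = c * L X Y Z V q) ->
  P X -> P Y -> P Z -> P V ->
  bochner n J gb Lb X Y Z V q = c * bochner n J g L X Y Z V q.
Proof.
move=> gU c0 gbE LE PX PY PZ PV.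
have ctrE F : contract (gb q) F = c^-1 * contract (g q) F.
  rewrite -contractZ /contract gbE invmxZ ?unitmxZ ?unitfE//.
  by apply: eq_bigr => a _; apply: eq_bigr => b _; rewrite mxE; ring.
have ricE A B : P A -> P B -> ricci gb Lb A B q = ricci g L A B q.
  move=> PA PB; rewrite /ricci /trace -!/(contract _ _) ctrE -contractZ.
  by apply: eq_contract => a b; rewrite LE// mulKf.
have scE : scal gb Lb q = c^-1 * scal g L q.
  rewrite /scal /trace -!/(contract _ _) ctrE; congr (_ * _).
  by apply: eq_contract => a b; exact: ricE.
have scsE : scal_star J gb Lb q = c^-1 * scal_star J g L q.
  rewrite /scal_star /trace -!/(contract _ _) ctrE; congr (_ * _).
  by apply: eq_contract => a b; apply: ricE => //; exact: PJ.
have inE A B : inner gb A B q = c * inner g A B q.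
  by rewrite /inner -!/(bil _ _ _) gbE bilZm.
rewrite /bochner scE scsE LE// /pi1 /pi2 /pi3 /psi1 /psi2 /assoc_metric.
rewrite !ricE//; try exact: PJ.
rewrite !inE.
(* The constants depending on n become opaque, so that [field] asks for no condition on them. *)
set k1 := (_ * _)^-1; set k2 := (_ * _)^-1.
by field.
Qed.

End Linearity.
End Bochner.

(** * Curvature of a deformed connection *)

Section Pointwise.
Variables (R : realType) (m : nat) (g J : 'M[R]_m).
Hypotheses (gs : g^T = g) (JJ : J *m J = - 1%:M).
Hypothesis gJ : J *m g *m J^T = - g.
Local Notation G := (bil g).
Local Notation "v \J" := (v *m J) (at level 2, format "v \J").

(* Let i act as J, and put w = g(., p), wc = w - i (w o J) and
   gc = g - i g(., J .): this is (a + i b) y + wc(y) x - gc(x, y) p, and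
   deviation_form is the real part of
   (D_x wc)(y) - wc(x) wc(y) + gc(x, y) wc(p) / 2, where tx is D_x p corrected
   by the Weyl form so that g(tx, y) = (D_x w)(y). *)
Definition deviation (p : 'rV[R]_m) (a b : R) (x y : 'rV[R]_m) : 'rV[R]_m :=
  a *: y + b *: y\J + G y p *: x - G y\J p *: x\J - G x y *: p + G x y\J *: p\J.

Definition deviation_form (p x y tx : 'rV[R]_m) : R :=
  G tx y - (G x p * G y p - G x\J p * G y\J p)
  + 2^-1 * (G p p * G x y - G p p\J * G x y\J).

Let GJ v w : G v\J w = G v w\J. Proof. exact: bil_app. Qed.
Let GJJ (v : 'rV[R]_m) : v\J\J = - v. Proof. exact: app_app. Qed.
Let GC v w : G v w = G w v. Proof. exact: bilC. Qed.
Let GCJ v w : G v w\J = G w v\J. Proof. by rewrite -GJ GC. Qed.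

(* The derivative along X of D_Y Z + deviation p aY bY Y Z at a point, where
   dxy stands for D_X Y, and so on, ddz for D_X D_Y Z, fx for the Weyl form on
   X, and da, db for the derivatives of the coefficients aY, bY. *)
Definition deviation_derivative (p : 'rV[R]_m) (aY bY : R)
    (y z dxy dxz dxp ddz : 'rV[R]_m)
    (fx da db : R) : 'rV[R]_m :=
  ddz + (da *: z + aY *: dxz) + (db *: z\J + bY *: dxz\J)
  + ((G dxz p + G z dxp - 2 * fx * G z p) *: y + G z p *: dxy)
  - ((G dxz\J p + G z\J dxp - 2 * fx * G z\J p) *: y\J + G z\J p *: dxy\J)
  - ((G dxy z + G y dxz - 2 * fx * G y z) *: p + G y z *: dxp)
  + ((G dxy z\J + G y dxz\J - 2 * fx * G y z\J) *: p\J + G y z\J *: dxp\J).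

(** All derivatives are free vectors, so this is an algebraic identity. The two premises say that a
    and b are closed: a + i b acts by complex scalars, which commute with the remaining terms, so it
    can enter only through its exterior derivative. *)
Lemma curvature_deviation (p x y z v dxy dyx dxz dyz dxp dyp ddx ddy dbz :
    'rV[R]_m) (fx fy ax ay bx by' ab bb dax day dbx dby : R) :
  day - dax = ab -> dby - dbx = bb ->
  G (deviation_derivative p ay by' y z dxy dxz dxp ddx fx day dby
     + deviation p ax bx x (dyz + deviation p ay by' y z)
     - (deviation_derivative p ax bx x z dyx dyz dyp ddy fy dax dbx
        + deviation p ay by' y (dxz + deviation p ax bx x z))
     - (dbz + deviation p ab bb (dxy - dyx) z)) v =
  G (ddx - ddy - dbz) v
  - ((let s := deviation_form p in
      let tx := dxp - (2 * fx) *: p in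
      let ty := dyp - (2 * fy) *: p in
      G y z * s x v tx - G x z * s y v ty + G x v * s y z ty - G y v * s x z tx)
     - (let s := deviation_form p in
      let tx := dxp - (2 * fx) *: p in
      let ty := dyp - (2 * fy) *: p in
      G y z\J * s x v\J tx - G x z\J * s y v\J ty
      + G x v\J * s y z\J ty - G y v\J * s x z\J tx)).
Proof.
move=> <- <-; rewrite /deviation_derivative /deviation /deviation_form /=.
rewrite ?(mulmxDl, mulmxBl, mulNmx, =^~ scalemxAl, bilDl, bilDr, bilNl, bilNr,
  bilZl, bilZr, GJ, GJJ).
(* The pairings are oriented, with J in the second argument, so that equal scalars become equal
   atoms. *)
rewrite ?(GC y x) ?(GC z x) ?(GC z y) ?(GC v x) ?(GC v y) ?(GC v z).
rewrite ?(GC p x) ?(GC p y) ?(GC p z) ?(GC p v).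
rewrite ?(GC x dyz) ?(GC y dxz) ?(GC z dxp) ?(GC z dyp).
rewrite ?(GCJ y x) ?(GCJ z x) ?(GCJ z y) ?(GCJ v x) ?(GCJ v y) ?(GCJ v z).
rewrite ?(GCJ p x) ?(GCJ p y) ?(GCJ p z) ?(GCJ p v).
rewrite ?(GCJ x dyz) ?(GCJ y dxz) ?(GCJ z dxp) ?(GCJ z dyp).
by field.
Qed.
End Pointwise.

(** * Local connections and closed forms *)

Section LocalConnection.
Variables (R : realType) (m : nat).
Local Notation E := 'rV[R]_m.
Local Notation vf := (E -> E).
Local Notation fn := (E -> R).
Variable W : set E.
Hypothesis oW : open W.
Local Notation smooth := (smooth_on W).

Record connection_on (D : vf -> vf -> vf) : Prop := ConnectionOn {
  con_smooth : forall X Y, smooth X -> smooth Y -> smooth (D X Y);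
  con_lin : forall (f : fn) X1 X2 Y, smooth f -> smooth X1 -> smooth X2 ->
    smooth Y -> forall q, W q ->
    D (fun x => f x *: X1 x + X2 x) Y q = f q *: D X1 Y q + D X2 Y q;
  con_add : forall X Y1 Y2, smooth X -> smooth Y1 -> smooth Y2 ->
    forall q, W q -> D X (fun x => Y1 x + Y2 x) q = D X Y1 q + D X Y2 q;
  con_leibniz : forall (f : fn) X Y, smooth f -> smooth X -> smooth Y ->
    forall q, W q ->
    D X (fun x => f x *: Y x) q = along X f q *: Y q + f q *: D X Y q
}.

Definition torsion_free (D : vf -> vf -> vf) : Prop :=
  forall X Y, smooth X -> smooth Y ->
  forall q, W q -> D X Y q - D Y X q = bracket X Y q.

Definition closed_on (w : vf -> fn) : Prop :=
  forall X Y, smooth X -> smooth Y -> forall q, W q -> ext_d w X Y q = 0.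

Lemma along_near (V : normedModType R) (X : vf) (f h : E -> V) q :
  (forall z, W z -> f z = h z) -> W q -> along X f q = along X h q.
Proof.
move=> fh Wq; apply: near_eq_derive.
by apply: (open_near_eq oW _ Wq) => z /set_mem; exact: fh.
Qed.

Lemma closed_on_ext (w w' : vf -> fn) :
  (forall X q, W q -> w X q = w' X q) -> closed_on w -> closed_on w'.
Proof.
move=> ww' cw X Y sX sY q Wq; rewrite -[RHS](cw X Y sX sY q Wq) /ext_d.
rewrite -(ww' (bracket X Y) q Wq).
by rewrite (along_near X (ww' Y) Wq) (along_near Y (ww' X) Wq).
Qed.

Lemma closed_on_comb (k l : R) (w w' : vf -> fn) :
  (forall X, smooth X -> smooth (w X)) ->
  (forall X, smooth X -> smooth (w' X)) ->
  closed_on w -> closed_on w' ->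
  closed_on (fun X q => k * w X q + l * w' X q).
Proof.
move=> sw sw' cw cw' X Y sX sY q Wq.
have al Z A : smooth A -> along Z (fun q => k * w A q + l * w' A q) q =
    k * along Z (w A) q + l * along Z (w' A) q.
  move=> sA; rewrite /along.
  have dw : derivable (w A) q (Z q) by exact: smooth_on_derivable (sw A sA) Wq.
  have dw' : derivable (w' A) q (Z q).
    by exact: smooth_on_derivable (sw' A sA) Wq.
  rewrite -[X in _ = X + _](deriveZ k dw) -[X in _ = _ + X](deriveZ l dw').
  exact: (deriveD (derivableZ (k := k) dw) (derivableZ (k := l) dw')).
have := cw X Y sX sY q Wq; have := cw' X Y sX sY q Wq.
rewrite /ext_d !al// => e e'.
transitivity (k * (along X (w Y) q - along Y (w X) q - w (bracket X Y) q) +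
  l * (along X (w' Y) q - along Y (w' X) q - w' (bracket X Y) q)).
  by ring.
by rewrite e e' !mulr0 addr0.
Qed.

Section Operators.
Variable D : vf -> vf -> vf.
Hypothesis cD : connection_on D.

Lemma smooth_frame a : smooth (frame a : vf).
Proof. exact: smooth_on_cst. Qed.

(** The indicator function of the complement of W is smooth on W, where it vanishes, so the Leibniz
    rule applies to it. This yields locality. *)
Let off (x : E) : R := if x \in W then 0 else 1.

Let smooth_off : smooth off.
Proof.
apply: (@smooth_on_ext _ _ _ oW _ (fun=> 0)); last exact: smooth_on_cst.
by move=> q Wq; rewrite /off mem_set.
Qed.

Let off0 q : W q -> off q = 0.
Proof. by move=> Wq; rewrite /off mem_set. Qed.

Let off_fill (X X' : vf) : (forall z, W z -> X z = X' z) ->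
  X = (fun x => off x *: (X x - X' x) + X' x).
Proof.
move=> XX; apply/funext => x; rewrite /off; case: ifPn => [/set_mem Wx|_].
  by rewrite scale0r add0r XX.
by rewrite scale1r subrK.
Qed.

(** [off] carries the difference of Y and Y' outside W. Identities between connections hold on W
    only, and this lemma allows their use under a further derivative. *)
Lemma con_extr (X Y Y' : vf) q : smooth X -> smooth Y -> smooth Y' ->
  (forall z, W z -> Y z = Y' z) -> W q -> D X Y q = D X Y' q.
Proof.
move=> sX sY sY' YY Wq; rewrite [in LHS](off_fill YY).
have sB : smooth (fun x => Y x - Y' x) by exact: smooth_onB.
rewrite (con_add cD sX (smooth_onZ oW smooth_off sB) sY' Wq).
rewrite (con_leibniz cD smooth_off sX sB Wq) off0// scale0r YY// subrr.
by rewrite scaler0 !add0r.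
Qed.

Lemma con_addZ (X Y : vf) (f : fn) (Z : vf) q :
  smooth X -> smooth Y -> smooth f -> smooth Z ->
  W q -> D X (fun x => Y x + f x *: Z x) q =
         D X Y q + (along X f q *: Z q + f q *: D X Z q).
Proof.
move=> sX sY sf sZ Wq; rewrite (con_add cD sX sY _ Wq); last exact: smooth_onZ.
by rewrite (con_leibniz cD sf sX sZ Wq).
Qed.

Lemma con_subZ (X Y : vf) (f : fn) (Z : vf) q :
  smooth X -> smooth Y -> smooth f -> smooth Z ->
  W q -> D X (fun x => Y x - f x *: Z x) q =
         D X Y q - (along X f q *: Z q + f q *: D X Z q).
Proof.
move=> sX sY sf sZ Wq.
have sN : smooth (fun x => - f x).
  under eq_fun do rewrite -mulN1r.
  by apply: smooth_onM => //; exact: smooth_on_cst.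
transitivity (D X (fun x => Y x + (- f x) *: Z x) q).
  by congr (D X _ q); apply/funext => x; rewrite scaleNr.
rewrite con_addZ//; congr (_ + _).
rewrite opprD -!scaleNr; congr (_ *: _ + _).
by rewrite /along -deriveN//; exact: smooth_on_derivable Wq.
Qed.

(** Linearity over functions makes D X Y at q depend on X through X q alone; expanding X in the
    coordinate frame gives the matrix. *)
Lemma con_frame (X Y : vf) q : smooth X -> smooth Y -> W q ->
  D X Y q = X q *m \matrix_(a < m) D (frame a) Y q.
Proof.
move=> sX sY Wq; rewrite mulmx_sum_row.
under eq_bigr do rewrite rowK.
have sXa a : smooth (fun x => X x 0 a) by move/(smooth_on_mxP oW) : sX; exact.
(* The zero field is (-1) X + X, which has the shape of [con_lin]. *)
have D0 : D (fun=> 0) Y q = 0.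
  have sN : smooth (fun=> -1 : R) by exact: smooth_on_cst.
  have := con_lin cD sN sX sX sY Wq.
  under eq_fun do rewrite scaleN1r addNr.
  by rewrite scaleN1r addNr.
have H (r : seq 'I_m) : D (fun x => \sum_(a <- r) X x 0 a *: frame a x) Y q =
    \sum_(a <- r) X q 0 a *: D (frame a) Y q.
  elim: r => [|a r IH].
    by rewrite big_nil; under eq_fun do rewrite big_nil.
  under eq_fun do rewrite big_cons.
  rewrite big_cons -IH (con_lin cD (sXa a) (smooth_frame a))//.
  apply: smooth_on_sum => // b _; apply: smooth_onZ => //; exact: smooth_frame.
rewrite -H; congr (D _ Y q); apply/funext => x.
by rewrite {1}(row_sum_delta (X x)).
Qed.

(* Expanding D_v (f Y) by the Leibniz rule and by linearity in v: no Frechet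
   differentiability of f is needed. *)
Lemma derive_frame (f : fn) q (v : E) : (0 < m)%N -> smooth f -> W q ->
  'D_v f q = \sum_(a < m) v 0 a * 'D_(delta_mx 0 a) f q.
Proof.
move=> m0 sf Wq; pose Y : vf := frame (Ordinal m0); pose X : vf := fun=> v.
have sX : smooth X by exact: smooth_on_cst.
have sY : smooth Y by exact: smooth_frame.
have sfY : smooth (fun x => f x *: Y x) by exact: smooth_onZ.
have := con_leibniz cD sf sX sY Wq.
rewrite (con_frame sX sfY Wq) (con_frame sX sY Wq) !mulmx_sum_row.
under eq_bigr do
  rewrite rowK (con_leibniz cD sf (smooth_frame _) sY Wq) scalerDr.
under [in RHS]eq_bigr do rewrite rowK.
rewrite big_split scaler_sumr /=.
under [X in _ + X = _]eq_bigr do rewrite scalerA mulrC -scalerA.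
(* The sums of the terms f D Y agree; a multiple of the constant field Y remains on each side, and
   one component gives the claim. *)
move=> /addIr /(congr1 (fun A : E => A 0 (Ordinal m0))).
rewrite [RHS]mxE summxE /Y /frame mxE !eqxx mulr1 => e.
rewrite -[LHS]/(along X f q) -e.
by apply: eq_bigr => a _; rewrite !mxE !eqxx mulr1.
Qed.

Lemma closed_differential (f : fn) : (0 < m)%N -> smooth f ->
  closed_on (fun X => along X f).
Proof.
move=> m0 sf X Y sX sY q Wq.
have sfa v : smooth (fun z => 'D_v f z) by exact: smooth_on_derive.
(* Coordinates split the iterated derivative into a first derivative in the direction [along A B q]
   and a second derivative in directions frozen at q. In the exterior derivative the former make up
   the bracket term and the latter cancel by [derive_comm]. *)
have second A B : smooth A -> smooth B -> along A (along B f) q =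
    'D_(along A B q) f q + 'D_(A q) (fun z => 'D_(B q) f z) q.
  move=> sA sB; have sBa a : smooth (fun z => B z 0 a).
    by move/(smooth_on_mxP oW) : sB; exact.
  rewrite (along_near A (h := fun z =>
    \sum_(a < m) B z 0 a * 'D_(delta_mx 0 a) f z) _ Wq); last first.
    by move=> z Wz; exact: (derive_frame _ m0 sf Wz).
  have dB a : derivable (fun z => B z 0 a) q (A q).
    exact: smooth_on_derivable (sBa a) Wq.
  have df a : derivable (fun z => 'D_(delta_mx 0 a) f z) q (A q).
    exact: smooth_on_derivable (sfa _) Wq.
  rewrite /along (_ : (fun z => _) = \sum_(a < m)
    ((fun z => B z 0 a) * (fun z => 'D_(delta_mx 0 a) f z))); last first.
    by apply/funext => z; rewrite fct_sumE.
  rewrite derive_sum; last by move=> a; exact: derivableM.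
  under eq_bigr do rewrite deriveM//.
  rewrite big_split [LHS]addrC /=; congr (_ + _).
    rewrite [RHS](derive_frame _ m0 sf Wq); apply: eq_bigr => a _.
    rewrite derive_mx ?mxE; last exact: smooth_on_derivable sB Wq.
    by rewrite mulrC.
  rewrite -[LHS](_ : 'D_(A q) (\sum_(a < m)
    (B q 0 a *: (fun z => 'D_(delta_mx 0 a) f z))) q = _).
    apply: near_eq_derive; apply: (open_near_eq oW _ Wq) => z /set_mem Wz.
    by rewrite fct_sumE [RHS](derive_frame _ m0 sf Wz).
  rewrite derive_sum; last by move=> a; exact: derivableZ.
  by apply: eq_bigr => a _; rewrite deriveZ.
have cancel (a b c s : R) : a + s - (b + s) - c = a - b - c by ring.
have swap : 'D_(Y q) (fun z => 'D_(X q) f z) q =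
    'D_(X q) (fun z => 'D_(Y q) f z) q := derive_comm oW _ _ sf Wq.
rewrite /ext_d (second X Y sX sY) (second Y X sY sX) swap cancel.
rewrite /along /bracket.
have add v w : 'D_(v - w) f q = 'D_v f q - 'D_w f q.
  rewrite !(derive_frame _ m0 sf Wq) -sumrB; apply: eq_bigr => a _.
  by rewrite !mxE mulrBl.
by rewrite add subrr.
Qed.

End Operators.
End LocalConnection.

(** * Curvature of a complex Weyl connection plus a deviation *)

Section WeylConnection.
Variables (R : realType) (n : nat).
Local Notation m := (2 * n)%N.
Local Notation E := 'rV[R]_m.
Local Notation vf := (E -> E).
Local Notation fn := (E -> R).
Variable W : set E.
Hypothesis oW : open W.
Local Notation smooth := (smooth_on W).
Variables J g : E -> 'M[R]_m.
Hypotheses (sJ : smooth J) (sg : smooth g).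
Hypothesis gs : forall q, W q -> (g q)^T = g q.
Hypothesis JJ : forall q, W q -> J q *m J q = - 1%:M.
Hypothesis gJ : forall q, W q -> J q *m g q *m (J q)^T = - g q.

Lemma smooth_app (X : vf) : smooth X -> smooth (app J X).
Proof. by move=> sX; exact: smooth_on_mulmx. Qed.

Lemma smooth_inner (X Y : vf) : smooth X -> smooth Y -> smooth (inner g X Y).
Proof.
move=> sX sY; have : smooth (fun q => X q *m g q *m (Y q)^T).
  by apply: smooth_on_mulmx; [|apply: smooth_on_mulmx|exact: smooth_on_trmx].
by move/(smooth_on_mxP oW); exact.
Qed.

Lemma smooth_addZ (Y : vf) (f : fn) (Z : vf) :
  smooth Y -> smooth f -> smooth Z -> smooth (fun x => Y x + f x *: Z x).
Proof. by move=> sY sf sZ; apply: smooth_onD => //; exact: smooth_onZ. Qed.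

Lemma smooth_subZ (Y : vf) (f : fn) (Z : vf) :
  smooth Y -> smooth f -> smooth Z -> smooth (fun x => Y x - f x *: Z x).
Proof. by move=> sY sf sZ; apply: smooth_onB => //; exact: smooth_onZ. Qed.

(** With phi = g(., Phi) this is D g = -2 phi g; for Phi = 0 it is compatibility with the metric. *)
Definition weyl_compatible (D : vf -> vf -> vf) (Phi : vf) : Prop :=
  forall X Y Z, smooth X -> smooth Y -> smooth Z -> forall q, W q ->
  along X (inner g Y Z) q = inner g (D X Y) Z q + inner g Y (D X Z) q
    - 2 * inner g X Phi q * inner g Y Z q.

Definition complex_connection (D : vf -> vf -> vf) : Prop :=
  forall X Y, smooth X -> smooth Y -> forall q, W q ->
  D X (app J Y) q = D X Y q *m J q.

Variables (D : vf -> vf -> vf) (Phi : vf).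
Hypotheses (cD : connection_on W D) (tD : torsion_free W D).
Hypotheses (wD : weyl_compatible D Phi) (jD : complex_connection D).
Variables A B P : vf.
Hypotheses (sA : smooth A) (sB : smooth B) (sP : smooth P).
Hypotheses (clA : closed_on W (fun X => inner g X A))
  (clB : closed_on W (fun X => inner g X B))
  (clP : closed_on W (fun X => inner g X P))
  (clJP : closed_on W (fun X => inner g X (app J P))).

Definition weyl_derivative (X : vf) : vf :=
  fun q => D X P q - (2 * inner g X Phi q) *: P q.

(** As D has no torsion, the exterior derivative of g(., P) is its antisymmetrized covariant
    derivative. *)
Lemma weyl_derivative_sym X Y q : smooth X -> smooth Y -> W q ->
  bil (g q) (weyl_derivative X q) (Y q) =
  bil (g q) (weyl_derivative Y q) (X q).
Proof.
move=> sX sY Wq; have := clP sX sY Wq.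
rewrite /ext_d !wD// /inner -!/(bil _ _ _) -(tD sX sY Wq).
rewrite /weyl_derivative !(bilDl, bilNl, bilZl) /inner -!/(bil _ _ _).
rewrite !(bilC (D _ P q) _ (gs Wq)).
rewrite (bilC (P q) (X q) (gs Wq)) (bilC (P q) (Y q) (gs Wq)) => e.
by apply/eqP; rewrite -subr_eq0 -[X in _ == X]e; apply/eqP; ring.
Qed.

(** The same for g(., J P): D commutes with J, so the covariant derivative of this form is that of
    g(., P) composed with J. *)
Lemma weyl_derivative_symJ X Y q : smooth X -> smooth Y -> W q ->
  bil (g q) (weyl_derivative X q) (Y q *m J q) =
  bil (g q) (weyl_derivative Y q) (X q *m J q).
Proof.
move=> sX sY Wq; have sJP := smooth_app sP; have := clJP sX sY Wq.
rewrite /ext_d !wD// /inner -!/(bil _ _ _) !jD// -(tD sX sY Wq) /app.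
rewrite /weyl_derivative !(bilDl, bilNl, bilZl) /inner -!/(bil _ _ _).
rewrite !(bilC (D _ P q) _ (gs Wq)) !(bilC (P q) _ (gs Wq)).
rewrite !(bil_app (JJ Wq) (gJ Wq)) => e.
by apply/eqP; rewrite -subr_eq0 -[X in _ == X]e; apply/eqP; ring.
Qed.

Definition weyl_matrix (q : E) : 'M[R]_m :=
  \matrix_(a < m) D (frame a) P q - 2 *: (g q *m (Phi q)^T *m P q).

Lemma weyl_matrixE X q : smooth X -> W q ->
  weyl_derivative X q = X q *m weyl_matrix q.
Proof.
move=> sX Wq; rewrite /weyl_derivative /weyl_matrix mulmxBr.
rewrite -(con_frame oW cD sX sP Wq) -scalemxAr !mulmxA.
by rewrite [X q *m _ *m _]mx11_scalar mul_scalar_mx scalerA.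
Qed.

(** The tensor S of psi1 - psi2, as a matrix; the rank one products encode products of 1-forms. *)
Definition deviation_matrix (q : E) : 'M[R]_m :=
  let G := g q in let p := P q in
  weyl_matrix q *m G
  - (G *m p^T *m p *m G - J q *m G *m p^T *m p *m (G *m (J q)^T))
  + 2^-1 *: (bil G p p *: G - bil G p (p *m J q) *: (G *m (J q)^T)).

Lemma deviation_matrixE q x y : W q ->
  bil (deviation_matrix q) x y =
  deviation_form (g q) (J q) (P q) x y (x *m weyl_matrix q).
Proof.
move=> Wq; rewrite /deviation_matrix /deviation_form.
rewrite !(bilDm, bilNm, bilZm) !bil_outer -!bil_mulmxr -!bil_mulmxl.
rewrite !(bil_app (JJ Wq) (gJ Wq)).
rewrite (bilC (P q) y (gs Wq)) (bilC (P q) (y *m J q) (gs Wq)).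
by rewrite !(bil_app (JJ Wq) (gJ Wq)).
Qed.

(** With w = g(., P) the two symmetries give (D_Jx w)(Jy) = (D_y w)(JJx) = -(D_y w)(x) = -(D_x
    w)(y). The remaining terms change sign by J^2 = -1. *)
Lemma deviation_matrix_norden q : W q ->
  J q *m deviation_matrix q *m (J q)^T = - deviation_matrix q.
Proof.
move=> Wq; apply: bil_ext => v w.
rewrite bilNm -bil_mulmxr -bil_mulmxl !deviation_matrixE//.
have sv : smooth (fun=> v) by exact: smooth_on_cst.
have sw : smooth (fun=> w) by exact: smooth_on_cst.
have e1 := weyl_derivative_symJ (smooth_app sv) sw Wq.
have e2 := weyl_derivative_sym sv sw Wq.
move: e1 e2; rewrite !weyl_matrixE//; last exact: smooth_app.
rewrite /app /deviation_form !(bil_app (JJ Wq) (gJ Wq)).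
rewrite !(app_app (JJ Wq)) !(mulNmx, bilNl, bilNr) => e1 e2.
by rewrite e1 -e2; ring.
Qed.

Lemma con_deviation X Y Z q : smooth X -> smooth Y -> smooth Z -> W q ->
  D X (fun x => D Y Z x + deviation (g x) (J x) (P x) (inner g Y A x)
                  (inner g Y B x) (Y x) (Z x)) q =
  deviation_derivative (g q) (J q) (P q) (inner g Y A q) (inner g Y B q)
    (Y q) (Z q)
    (D X Y q) (D X Z q) (D X P q) (D X (D Y Z) q) (inner g X Phi q)
    (along X (inner g Y A) q) (along X (inner g Y B) q).
Proof.
move=> sX sY sZ Wq.
have sJY := smooth_app sY; have sJZ := smooth_app sZ.
have sJP := smooth_app sP.
transitivity (D X (fun x => D Y Z x + inner g Y A x *: Z x
    + inner g Y B x *: app J Z x + inner g Z P x *: Y x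
    - inner g (app J Z) P x *: app J Y x - inner g Y Z x *: P x
    + inner g Y (app J Z) x *: app J P x) q).
  by congr (D X _ q); apply/funext => x; rewrite /deviation !addrA.
have s0 := con_smooth cD sY sZ.
have s1 := smooth_addZ s0 (smooth_inner sY sA) sZ.
have s2 := smooth_addZ s1 (smooth_inner sY sB) sJZ.
have s3 := smooth_addZ s2 (smooth_inner sZ sP) sY.
have s4 := smooth_subZ s3 (smooth_inner sJZ sP) sJY.
have s5 := smooth_subZ s4 (smooth_inner sY sZ) sP.
rewrite (con_addZ oW cD sX s5 (smooth_inner sY sJZ) sJP Wq).
rewrite (con_subZ oW cD sX s4 (smooth_inner sY sZ) sP Wq).
rewrite (con_subZ oW cD sX s3 (smooth_inner sJZ sP) sJY Wq).
rewrite (con_addZ oW cD sX s2 (smooth_inner sZ sP) sY Wq).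
rewrite (con_addZ oW cD sX s1 (smooth_inner sY sB) sJZ Wq).
rewrite (con_addZ oW cD sX s0 (smooth_inner sY sA) sZ Wq).
rewrite !(wD sX)// /deviation_derivative /inner -!/(bil _ _ _) !jD//.
Qed.

(** Torsion freeness turns the bracket into D X Y - D Y X, and [con_deviation] turns the iterated
    derivatives into pointwise data; [curvature_deviation] then applies. *)
Lemma curvature4_deviation (D' : vf -> vf -> vf) X Y Z V q :
  (forall X Y, smooth X -> smooth Y -> forall q, W q ->
    D' X Y q = D X Y q + deviation (g q) (J q) (P q)
      (inner g X A q) (inner g X B q) (X q) (Y q)) ->
  smooth X -> smooth Y -> smooth Z -> smooth V -> W q ->
  curvature4 g D' X Y Z V q =
  curvature4 g D X Y Z V q - psi12 J g (deviation_matrix q) X Y Z V q.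
Proof.
move=> D'E sX sY sZ sV Wq.
have sdev X' Y' : smooth X' -> smooth Y' ->
    smooth (fun x => D X' Y' x + deviation (g x) (J x) (P x)
      (inner g X' A x) (inner g X' B x) (X' x) (Y' x)).
  move=> sX' sY'; rewrite /deviation.
  have sJX' := smooth_app sX'; have sJY' := smooth_app sY'.
  have sJP := smooth_app sP.
  apply: smooth_onD => //; first exact: con_smooth.
  apply: (smooth_addZ _ (smooth_inner sX' sJY') sJP).
  apply: (smooth_subZ _ (smooth_inner sX' sY') sP).
  apply: (smooth_subZ _ (smooth_inner sJY' sP) sJX').
  apply: (smooth_addZ _ (smooth_inner sY' sP) sX').
  apply: (smooth_addZ _ (smooth_inner sX' sB) sJY').
  exact: (smooth_onZ oW (smooth_inner sX' sA) sY').
have sD' X' Y' : smooth X' -> smooth Y' -> smooth (D' X' Y').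
  move=> sX' sY'; apply: (smooth_on_ext oW _ (sdev _ _ sX' sY')) => z Wz.
  by rewrite D'E.
have sbr : smooth (bracket X Y).
  apply: (smooth_on_ext oW (f := fun z => D X Y z - D Y X z)).
    by move=> z Wz; exact: tD.
  by apply: smooth_onB => //; exact: con_smooth.
(* The formula for D' holds on W only, so its use under D X' rests on locality. *)
have DD X' Y' Z' : smooth X' -> smooth Y' -> smooth Z' ->
    D X' (D' Y' Z') q = D X' (fun x => D Y' Z' x +
      deviation (g x) (J x) (P x) (inner g Y' A x)
                  (inner g Y' B x) (Y' x) (Z' x)) q.
  move=> sX' sY' sZ'; apply: (con_extr oW cD sX' _ _ _ Wq).
  - exact: sD'.
  - exact: sdev.
  - by move=> z Wz; rewrite D'E.
rewrite /curvature4 /curvature /inner -!/(bil _ _ _).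
rewrite !D'E//; try exact: sD'.
rewrite !DD// !con_deviation// -(tD sX sY Wq).
rewrite curvature_deviation; [|exact: gs|exact: JJ|exact: gJ| |].
- congr (_ - _); rewrite /psi12 /psi1 /psi2 /tensor2 /inner /app -!/(bil _ _ _).
  rewrite !deviation_matrixE// -(weyl_matrixE sX Wq) -(weyl_matrixE sY Wq).
  by rewrite /weyl_derivative /inner -!/(bil _ _ _).
- by apply/eqP; rewrite -subr_eq0; apply/eqP; exact: clA.
- by apply/eqP; rewrite -subr_eq0; apply/eqP; exact: clB.
Qed.

End WeylConnection.

(** * Conformal change *)

Section ConformalChange.
Variables (R : realType) (n : nat).
Local Notation m := (2 * n)%N.
Local Notation E := 'rV[R]_m.
Local Notation vf := (E -> E).
Local Notation fn := (E -> R).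
Variable W : set E.
Hypothesis oW : open W.
Local Notation smooth := (smooth_on W).
Variable J : E -> 'M[R]_m.
Hypotheses (sJ : smooth J) (JJ : forall q, W q -> J q *m J q = - 1%:M).

Record norden_on (g : E -> 'M[R]_m) : Prop := NordenOn {
  norden_smooth : smooth g;
  norden_unit : forall q, W q -> g q \in unitmx;
  norden_sym : forall q, W q -> (g q)^T = g q;
  norden_J : forall q, W q -> J q *m g q *m (J q)^T = - g q
}.

(** If N is the g-gradient of v, this is the Levi-Civita connection of e^(2v) g. It serves for the
    gradient of u and for the vector dual to theta o J / 2n. *)
Definition conformal_connection (g : E -> 'M[R]_m) (D : vf -> vf -> vf)
    (N X Y : vf) : vf :=
  fun q => D X Y q + inner g X N q *: Y q + inner g Y N q *: X q
           - inner g X Y q *: N q.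

Section OneMetric.
Variables (g : E -> 'M[R]_m) (D : vf -> vf -> vf) (N : vf).
Hypotheses (Ng : norden_on g) (cD : connection_on W D) (tD : torsion_free W D).
Hypothesis sN : smooth N.
Local Notation DN := (conformal_connection g D N).
Let sg := norden_smooth Ng.
Let gs := norden_sym Ng.

Lemma conformal_connection_on : connection_on W DN.
Proof.
have si X Y : smooth X -> smooth Y -> smooth (inner g X Y).
  by move=> sX sY; exact: smooth_inner.
split.
- move=> X Y sX sY; apply: smooth_subZ => //; last exact: si.
  apply: smooth_addZ => //; last exact: si.
  apply: smooth_addZ => //; last exact: si.
  exact: con_smooth.
- move=> f X1 X2 Y sf sX1 sX2 sY q Wq; rewrite /conformal_connection.
  rewrite (con_lin cD sf sX1 sX2 sY Wq) /inner -!/(bil _ _ _).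
  rewrite !(bilDl, bilDr, bilZl, bilZr).
  by apply/rowP => i; rewrite !mxE; ring.
- move=> X Y1 Y2 sX sY1 sY2 q Wq; rewrite /conformal_connection.
  rewrite (con_add cD sX sY1 sY2 Wq) /inner -!/(bil _ _ _).
  rewrite !(bilDl, bilDr, bilZl, bilZr).
  by apply/rowP => i; rewrite !mxE; ring.
- move=> f X Y sf sX sY q Wq; rewrite /conformal_connection.
  rewrite (con_leibniz cD sf sX sY Wq) /inner -!/(bil _ _ _).
  rewrite !(bilDl, bilDr, bilZl, bilZr).
  by apply/rowP => i; rewrite !mxE; ring.
Qed.

Lemma conformal_torsion_free : torsion_free W DN.
Proof.
move=> X Y sX sY q Wq; rewrite -(tD sX sY Wq) /conformal_connection.
rewrite /inner -!/(bil _ _ _) (bilC (Y q) (X q) (gs Wq)).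
by apply/rowP => i; rewrite !mxE; ring.
Qed.

Lemma conformal_weyl_compatible :
  weyl_compatible W g D (fun=> 0) -> weyl_compatible W g DN N.
Proof.
move=> wD X Y Z sX sY sZ q Wq; rewrite wD// /conformal_connection.
rewrite /inner -!/(bil _ _ _).
have b0 v : bil (g q) v 0 = 0 by rewrite -(scale0r 0) bilZr mul0r.
rewrite !(bilDl, bilDr, bilZl, bilZr, bilNl, bilNr) b0.
rewrite (bilC (Y q) (X q) (gs Wq)) (bilC (N q) (Z q) (gs Wq)).
by ring.
Qed.

End OneMetric.

(* Koszul's argument *)
Lemma weyl_compatible_uniq (g : E -> 'M[R]_m) (D D2 : vf -> vf -> vf) Phi
    X Y q :
  norden_on g -> torsion_free W D -> torsion_free W D2 ->
  weyl_compatible W g D Phi -> weyl_compatible W g D2 Phi ->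
  smooth X -> smooth Y -> W q -> D X Y q = D2 X Y q.
Proof.
move=> Ng tD tD2 wD wD2 sX sY Wq.
apply: (bil_inj (norden_unit Ng Wq)) => a.
have sZ : smooth (frame a : vf) by exact: smooth_frame.
set Z := frame a in sZ; rewrite -[delta_mx 0 a]/(Z q).
have gC v w : bil (g q) v w = bil (g q) w v by exact: bilC (norden_sym Ng Wq).
(* The difference of the two connections is symmetric in its first two arguments and skew in the
   last two; alternating both symmetries six times returns it to its own negative. *)
pose d A B C := bil (g q) (D A B q) (C q) - bil (g q) (D2 A B q) (C q).
have dsym A B C : smooth A -> smooth B -> d A B C = d B A C.
  move=> sA sB; have : D A B q - D B A q = D2 A B q - D2 B A q.
    by rewrite tD// tD2.
  move=> /(congr1 (fun v => bil (g q) v (C q))).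
  rewrite !(bilDl, bilNl) /d => e.
  by apply/eqP; rewrite -subr_eq0; apply/eqP; move: e => /eqP;
    rewrite -subr_eq0 => /eqP <-; ring.
have dskew A B C : smooth A -> smooth B -> smooth C -> d A B C = - d A C B.
  move=> sA sB sC; have := wD A B C sA sB sC q Wq; rewrite wD2//.
  rewrite /inner -!/(bil _ _ _) !(gC (B q)) /d => /eqP.
  rewrite -subr_eq0 => /eqP e.
  apply/eqP; rewrite -subr_eq0 opprK; apply/eqP.
  by rewrite -[RHS]oppr0 -e; ring.
have d0 : d X Y Z = 0.
  suff : d X Y Z + d X Y Z = 0.
    by rewrite -mulr2n => /eqP; rewrite mulrn_eq0 => /eqP.
  rewrite {1}(dskew X Y Z)// (dsym X Z Y)// (dskew Z X Y)// (dsym Z Y X)//.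
  by rewrite (dskew Y Z X)// (dsym Y X Z)// opprK addNr.
by apply/eqP; rewrite -subr_eq0; apply/eqP.
Qed.

(** An explicit vector dual to theta. Its smoothness can be read off, and nondegeneracy identifies
    it with the given [Omega]. *)
Definition lie_vector (g : E -> 'M[R]_m) (D : vf -> vf -> vf) : vf := fun q =>
  \sum_(a < m) \sum_(b < m)
    invmx (g q) a b *: nabla_endo J D (frame a) (frame b) q.

Lemma lie_formE (g : E -> 'M[R]_m) D X q : norden_on g -> W q ->
  lie_form J g D X q = inner g X (lie_vector g D) q.
Proof.
move=> Ng Wq; rewrite /inner -/(bil _ _ _) (bilC _ _ (norden_sym Ng Wq)).
rewrite /lie_vector bil_suml; apply: eq_bigr => a _; rewrite bil_suml.
by apply: eq_bigr => b _; rewrite bilZl.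
Qed.

Lemma smooth_lie_vector (g : E -> 'M[R]_m) D : norden_on g ->
  connection_on W D -> smooth (lie_vector g D).
Proof.
move=> Ng cD; apply: smooth_on_sum => // a _; apply: smooth_on_sum => // b _.
have sF c : smooth (frame c : vf) by exact: smooth_frame.
apply: smooth_onZ => //.
  have : smooth (fun q => invmx (g q)).
    by apply: smooth_on_invmx => //; [exact: norden_unit|exact: norden_smooth].
  by move/(smooth_on_mxP oW); exact.
apply: smooth_onB => //; first by apply: con_smooth => //; exact: smooth_app.
by apply: smooth_app => //; exact: con_smooth.
Qed.

End ConformalChange.

(** * The Kaehler connection of a W1-manifold *)

Section LieForms.
Variables (R : realType) (n : nat).
Local Notation m := (2 * n)%N.
Local Notation E := 'rV[R]_m.
Local Notation vf := (E -> E).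
Local Notation fn := (E -> R).
Variable W : set E.
Hypothesis oW : open W.
Local Notation smooth := (smooth_on W).
Variable J : E -> 'M[R]_m.
Hypotheses (sJ : smooth J) (JJ : forall q, W q -> J q *m J q = - 1%:M).

(* With dv = theta o J / 2n, which is closed, kahler_connection below is the
   Levi-Civita connection of the local Kaehler metric e^(2v) g. *)
Definition kahler_vector (g : E -> 'M[R]_m) (D : vf -> vf -> vf) : vf :=
  fun q => m%:R^-1 *: app J (lie_vector J g D) q.

Definition kahler_connection (g : E -> 'M[R]_m) (D : vf -> vf -> vf) :=
  conformal_connection g D (kahler_vector g D).

Lemma smooth_kahler_vector (g : E -> 'M[R]_m) D : norden_on W J g ->
  connection_on W D -> smooth (kahler_vector g D).
Proof.
move=> Ng cD; apply: smooth_on_scale => //; apply: smooth_app => //.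
exact: smooth_lie_vector.
Qed.

(** The four terms that the deformation adds to (D_X J) Y, paired with Z, are the negatives of the
    four terms of the W1 identity. *)
Lemma W1_complex (g : E -> 'M[R]_m) (D : vf -> vf -> vf) :
  norden_on W J g ->
  (forall X Y Z, smooth X -> smooth Y -> smooth Z -> forall q, W q ->
    let th := lie_form J g D in
    let JY := app J Y in
    let JZ := app J Z in
    F_tensor J g D X Y Z q =
    m%:R^-1 * (inner g X Y q * th Z q + inner g X JY q * th JZ q
               + inner g X Z q * th Y q + inner g X JZ q * th JY q)) ->
  complex_connection W J (kahler_connection g D).
Proof.
move=> Ng W1 X Y sX sY q Wq.
apply: (bil_inj (norden_unit Ng Wq)) => a.
have sZ : smooth (frame a : vf) by exact: smooth_frame.
have := W1 X Y (frame a) sX sY sZ q Wq; cbv zeta.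
rewrite !(lie_formE _ _ Ng Wq) /F_tensor /nabla_endo /kahler_connection.
rewrite /kahler_vector /conformal_connection /inner -!/(bil _ _ _) /app.
rewrite -/(frame a q).
rewrite !(mulmxDl, mulmxBl, mulNmx, =^~ scalemxAl).
rewrite !(bilDl, bilDr, bilNl, bilNr, bilZl, bilZr).
have GJ := bil_app (JJ Wq) (norden_J Ng Wq).
rewrite !GJ !(app_app (JJ Wq)) !(mulNmx, bilNl, bilNr).
set L := lie_vector J g D q; set z := frame a q.
rewrite (bilC L z (norden_sym Ng Wq)).
rewrite (bilC L (z *m J q) (norden_sym Ng Wq)) -(GJ z L).
move=> /eqP; rewrite subr_eq => /eqP ->.
by ring.
Qed.

Lemma closed_inner_comb (g : E -> 'M[R]_m) (k l : R) (A B : vf) :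
  smooth g -> smooth A -> smooth B ->
  closed_on W (fun X => inner g X A) -> closed_on W (fun X => inner g X B) ->
  closed_on W (fun X => inner g X (fun q => k *: A q + l *: B q)).
Proof.
move=> sg sA sB cA cB.
have c : closed_on W (fun X q => k * inner g X A q + l * inner g X B q).
  by apply: closed_on_comb => // X sX; exact: smooth_inner.
apply: (closed_on_ext oW _ c) => X q Wq.
by rewrite /inner -!/(bil _ _ _) bilDr !bilZr.
Qed.

Section Gradient.
Variables (g : E -> 'M[R]_m) (D : vf -> vf -> vf) (f : fn).
Hypotheses (Ng : norden_on W J g) (cD : connection_on W D).
Hypotheses (m0 : (0 < m)%N) (sf : smooth f).

Definition gradient : vf :=
  fun q => (\row_a 'D_(delta_mx 0 a) f q) *m invmx (g q).

Lemma smooth_gradient : smooth gradient.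
Proof.
apply: smooth_on_mulmx => //.
  apply/(smooth_on_mxP oW) => i j; under eq_fun do rewrite mxE.
  exact: smooth_on_derive.
apply: smooth_on_invmx => //; first exact: norden_unit Ng.
exact: norden_smooth Ng.
Qed.

(** This rests on linearity of the directional derivative in its direction, which [derive_frame]
    draws from the connection D. *)
Lemma inner_gradient X q : W q -> inner g X gradient q = along X f q.
Proof.
move=> Wq; rewrite /inner /gradient trmx_mul trmx_inv (norden_sym Ng Wq).
rewrite mulmxA mulmxK ?(norden_unit Ng)// mxE /along.
rewrite (derive_frame oW cD (X q) m0 sf Wq).
by apply: eq_bigr => a _; rewrite !mxE.
Qed.

End Gradient.

(** * Comparison of the objects of g and of e^(2f) g *)

Section Comparison.
Variables (g gb : E -> 'M[R]_m) (D Db : vf -> vf -> vf) (f : fn).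
Hypotheses (Ng : norden_on W J g) (m0 : (0 < m)%N) (sf : smooth f).
Hypotheses (cD : connection_on W D) (tD : torsion_free W D).
Hypothesis wD : weyl_compatible W g D (fun=> 0).
Hypothesis gbE : forall q, W q -> gb q = expR (2 * f q) *: g q.
Hypotheses (cDb : connection_on W Db) (tDb : torsion_free W Db).
Hypothesis wDb : weyl_compatible W gb Db (fun=> 0).

Local Notation e := (fun q => expR (2 * f q)).
Local Notation U := (gradient g f).

Let e_neq0 q : e q != 0.
Proof. by rewrite gt_eqF// expR_gt0. Qed.

Let smooth_e : smooth e.
Proof.
by apply: smooth_on_expR => //; apply: smooth_onM => //; exact: smooth_on_cst.
Qed.

Let innerE X Y q : W q -> inner gb X Y q = e q * inner g X Y q.
Proof. by move=> Wq; rewrite /inner -!/(bil _ _ _) gbE// bilZm. Qed.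

Lemma norden_conformal : norden_on W J gb.
Proof.
split.
- apply: (smooth_on_ext oW (f := fun q => e q *: g q)) => [q Wq|].
    by rewrite gbE.
  by apply: smooth_onZ => //; exact: norden_smooth Ng.
- by move=> q Wq; rewrite gbE// unitmxZ ?unitfE//; exact: norden_unit Ng q Wq.
- by move=> q Wq; rewrite gbE// linearZ /= (norden_sym Ng).
- move=> q Wq; rewrite gbE// -scalemxAr -scalemxAl (norden_J Ng)//.
  by rewrite scalerN.
Qed.

Lemma along_expR X q : W q -> along X e q = 2 * along X f q * e q.
Proof.
move=> Wq; rewrite /along.
have df : derivable f q (X q) by exact: smooth_on_derivable sf Wq.
have d2 : derivable (fun x => 2 * f x) q (X q).
  exact: (derivableZ (k := 2) df).
have [_ E1] := is_derive_comp1 d2 (is_derive_expR (2 * f q)).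
rewrite [LHS]E1 mulrC; congr (_ * _).
exact: (deriveZ 2 df).
Qed.

(** Dividing the compatibility of Db with e^(2f) g by e^(2f) leaves the Weyl condition for g with
    vector grad f. The right side satisfies it too, and torsion free solutions are unique. *)
Lemma conformal_levi_civita X Y q : smooth X -> smooth Y -> W q ->
  Db X Y q = conformal_connection g D U X Y q.
Proof.
move=> sX sY Wq; apply: (weyl_compatible_uniq (Phi := U) Ng tDb _ _ _ sX sY Wq).
- exact: conformal_torsion_free Ng tD.
- move=> A B C sA sB sC {}q {}Wq; have := wDb sA sB sC Wq.
  have sBC : smooth (inner g B C).
    by apply: smooth_inner => //; exact: norden_smooth Ng.
  rewrite (along_near oW A (h := fun q => e q * inner g B C q) _ Wq);
    last first.
    by move=> z Wz; exact: innerE.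
  have de : derivable e q (A q) by exact: smooth_on_derivable smooth_e Wq.
  have di : derivable (inner g B C) q (A q).
    exact: smooth_on_derivable sBC Wq.
  rewrite [X in X = _ -> _](deriveM de di) -/(along A e q) along_expR//.
  rewrite (inner_gradient Ng cD m0 sf A Wq) !innerE//.
  rewrite -/(along A (inner g B C) q).
  have -> : inner g A (fun=> 0) q = 0 by rewrite /inner trmx0 mulmx0 mxE.
  have scE (a b : R) : a *: b = a * b by [].
  rewrite mulr0 mulr0 mul0r subr0 !scE => H.
  apply: (mulfI (e_neq0 q)); rewrite mulrBr mulrDr -H.
  by ring.
- exact: conformal_weyl_compatible Ng wD.
Qed.

Lemma bil_lie_vector (h : E -> 'M[R]_m) (D' : vf -> vf -> vf) G q w :
  bil G (lie_vector J h D' q) w = contract (h q) (fun a b =>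
    bil G (nabla_endo J D' (frame a) (frame b) q) w).
Proof.
rewrite /lie_vector bil_suml; apply: eq_bigr => a _; rewrite bil_suml.
by apply: eq_bigr => b _; rewrite bilZl.
Qed.

(** The conformal change adds four terms to the covariant derivative of J. Under the trace two of
    them cancel, one vanishes because J has trace zero, and the last is m J U. Hence theta changes
    by m df o J. *)
Lemma lie_vector_conformal q : W q ->
  e q *: lie_vector J gb Db q = lie_vector J g D q + m%:R *: (U q *m J q).
Proof.
move=> Wq; apply: (bil_inj (norden_unit Ng Wq)) => c.
set w := delta_mx 0 c; rewrite bilZl bilDl bilZl !bil_lie_vector.
have ctrE F : contract (gb q) F = (e q)^-1 * contract (g q) F.
  rewrite -contractZ /contract gbE// invmxZ; last first.
    by rewrite unitmxZ ?unitfE//; exact: norden_unit Ng q Wq.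
  by apply: eq_bigr => a _; apply: eq_bigr => b _; rewrite mxE; ring.
rewrite ctrE mulVKf//.
have gU := norden_unit Ng Wq; have gs := norden_sym Ng Wq.
have GJ := bil_app (JJ Wq) (norden_J Ng Wq).
pose d a : E := delta_mx 0 a.
transitivity (contract (g q) (fun a b =>
    bil (g q) (nabla_endo J D (frame a) (frame b) q) w
    + bil (g q) (d a) w * bil (g q) (U q *m J q) (d b)
    + - (bil (g q) (U q) w * bil (g q *m (J q)^T) (d a) (d b))
    + - (bil (g q) (d a) (w *m J q) * bil (g q) (U q) (d b))
    + bil (g q) (U q *m J q) w * bil (g q) (d a) (d b))).
  apply: eq_contract => a b; rewrite /nabla_endo.
  have sa : smooth (frame a : vf) by exact: smooth_frame.
  have sb : smooth (frame b : vf) by exact: smooth_frame.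
  have sJb : smooth (app J (frame b)) by exact: smooth_app.
  rewrite {1 2}/app !conformal_levi_civita// /conformal_connection.
  rewrite /inner -!/(bil _ _ _) /app -!/(frame _ q).
  rewrite !(mulmxDl, mulmxBl, mulNmx, =^~ scalemxAl).
  rewrite !(bilDl, bilNl, bilZl) -bil_mulmxr !GJ.
  rewrite !(bilC (U q) _ gs) -[frame a q]/(d a) -[frame b q]/(d b) !GJ.
  by ring.
rewrite !contractD !contractN !contractZ !contract_mul// !mulmxV// !mul1mx.
rewrite !contract_delta (gtr_self gU gs).
rewrite (gtr_assoc gU gs (JJ Wq) (norden_J Ng Wq)) -GJ.
by ring.
Qed.

(** The vector of gb is e^(-2f) (N - U), with N that of g. The factor cancels against gb = e^(2f) g,
    and the terms in -U undo the change from D to Db. *)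
Lemma kahler_connection_conformal X Y q : smooth X -> smooth Y -> W q ->
  kahler_connection gb Db X Y q = kahler_connection g D X Y q.
Proof.
move=> sX sY Wq; rewrite /kahler_connection /kahler_vector.
rewrite {1}/conformal_connection (conformal_levi_civita sX sY Wq).
rewrite (innerE X Y Wq) (innerE X _ Wq) (innerE Y _ Wq).
rewrite /conformal_connection /inner -!/(bil _ _ _) /app.
rewrite !bilZr.
have LE : lie_vector J gb Db q =
    (e q)^-1 *: (lie_vector J g D q + m%:R *: (U q *m J q)).
  by rewrite -lie_vector_conformal// scalerA mulVf// scale1r.
rewrite LE -!scalemxAl mulmxDl -scalemxAl (app_app (JJ Wq)).
move: (lie_vector J g D q *m J q) (U q) => L u.
rewrite !(bilDr, bilZr, bilNr).
have m1 : m%:R != 0 :> R by rewrite pnatr_eq0 -lt0n.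
apply/rowP => i; rewrite !mxE.
have n0 : n%:R != 0 :> R by move: m1; rewrite natrM mulf_eq0 negb_or => /andP[].
by field; rewrite e_neq0 n0.
Qed.

(** The change m df o J of theta is closed by pluriharmonicity, the second premise. *)
Lemma closed_lie_vector_conformal :
  closed_on W (fun X => inner g X (lie_vector J g D)) ->
  closed_on W (fun X => along (app J X) f) ->
  closed_on W (fun X => inner gb X (lie_vector J gb Db)).
Proof.
move=> c1 c2.
have sU := smooth_gradient Ng sf.
have sL := smooth_lie_vector oW sJ Ng cD.
have c2' : closed_on W (fun X => inner g X (app J U)).
  apply: (closed_on_ext oW _ c2) => X q Wq.
  rewrite -(inner_gradient Ng cD m0 sf (app J X) Wq).
  exact: bil_app (JJ Wq) (norden_J Ng Wq) _ _.
have sg := norden_smooth Ng.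
apply: (closed_on_ext oW _
  (closed_inner_comb 1 m%:R sg sL (smooth_app oW sJ sU) c1 c2')) => X q Wq.
rewrite innerE// /inner -!/(bil _ _ _) -bilZr.
by rewrite lie_vector_conformal// scale1r.
Qed.

(** By J^2 = -1, theta o J changes by -m df, which is closed for every smooth f. *)
Lemma closed_lie_vector_star_conformal :
  closed_on W (fun X => inner g X (app J (lie_vector J g D))) ->
  closed_on W (fun X => inner gb X (app J (lie_vector J gb Db))).
Proof.
move=> c1.
have sU := smooth_gradient Ng sf.
have sL := smooth_lie_vector oW sJ Ng cD.
have c2 : closed_on W (fun X => inner g X U).
  apply: (closed_on_ext oW _ (closed_differential oW cD m0 sf)) => X q Wq.
  by rewrite (inner_gradient Ng cD m0 sf X Wq).
have sg := norden_smooth Ng.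
apply: (closed_on_ext oW _
  (closed_inner_comb 1 (- m%:R) sg (smooth_app oW sJ sL) sU c1 c2)) => X q Wq.
rewrite innerE// /inner -!/(bil _ _ _) -bilZr /app.
rewrite [in RHS]scalemxAl lie_vector_conformal// mulmxDl -scalemxAl.
by rewrite (app_app (JJ Wq)) scale1r scaleNr scalerN.
Qed.

(** The connection is the same, hence so is its curvature endomorphism; only the metric lowering the
    index changes. *)
Lemma curvature4_kahler_conformal X Y Z V q :
  smooth X -> smooth Y -> smooth Z -> smooth V -> W q ->
  curvature4 gb (kahler_connection gb Db) X Y Z V q =
  e q * curvature4 g (kahler_connection g D) X Y Z V q.
Proof.
move=> sX sY sZ sV Wq.
have cK := conformal_connection_on oW Ng cD (smooth_kahler_vector Ng cD).
have cKb := conformal_connection_on oW norden_conformal cDb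
  (smooth_kahler_vector norden_conformal cDb).
have sK A B := con_smooth cK (X := A) (Y := B).
have sKb A B := con_smooth cKb (X := A) (Y := B).
have sbr : smooth (bracket X Y).
  apply: (smooth_on_ext oW (f := fun z => D X Y z - D Y X z)).
    by move=> z Wz; exact: tD.
  by apply: smooth_onB => //; exact: con_smooth.
have KK A B C : smooth A -> smooth B -> smooth C ->
    kahler_connection gb Db A (kahler_connection gb Db B C) q =
    kahler_connection g D A (kahler_connection g D B C) q.
  move=> sA sB sC.
  rewrite (kahler_connection_conformal sA (sKb _ _ sB sC) Wq).
  apply: (con_extr oW cK sA (sKb _ _ sB sC) (sK _ _ sB sC) _ Wq) => z Wz.
  exact: kahler_connection_conformal.
rewrite /curvature4 (innerE _ _ Wq) /inner /curvature.
rewrite (KK X Y Z sX sY sZ) (KK Y X Z sY sX sZ).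
by rewrite (kahler_connection_conformal sbr sZ Wq).
Qed.

End Comparison.

Lemma bochner_nabla' (g : E -> 'M[R]_m) (D : vf -> vf -> vf) (Omega : vf)
    (l1 l2 l3 l4 l5 l6 l7 l8 : R) X Y Z V q :
  (2 < n)%N -> norden_on W J g ->
  connection_on W D -> torsion_free W D -> weyl_compatible W g D (fun=> 0) ->
  complex_connection W J (kahler_connection g D) ->
  closed_on W (fun X => inner g X (lie_vector J g D)) ->
  closed_on W (fun X => inner g X (app J (lie_vector J g D))) ->
  (forall q, W q -> Omega q = lie_vector J g D q) ->
  l7 = - l5 -> l8 = - l6 ->
  smooth X -> smooth Y -> smooth Z -> smooth V -> W q ->
  bochner n J g
    (curvature4 g (nabla' n l1 l2 l3 l4 l5 l6 l7 l8 J g D Omega)) X Y Z V q =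
  bochner n J g (curvature4 g (kahler_connection g D)) X Y Z V q.
Proof.
move=> n2 Ng cD tD wD jD cL cJL OmE -> -> sX sY sZ sV Wq.
set D' := nabla' _ _ _ _ _ _ _ _ _ _ _ _ _.
set L := lie_vector J g D in cL cJL OmE.
have sL : smooth L by exact: smooth_lie_vector.
have sJL : smooth (app J L) by exact: smooth_app.
(* Combinations of L and J L are stable under J, and their dual forms are closed because theta and
   theta o J are. This covers A, B, P and J P. *)
pose comb k l : vf := fun q => k *: L q + l *: app J L q.
have sC k l : smooth (comb k l).
  by apply: smooth_onD => //; exact: smooth_on_scale.
have cC k l : closed_on W (fun X => inner g X (comb k l)).
  by apply: closed_inner_comb => //; exact: norden_smooth Ng.
have JC k l x : W x -> app J (comb k l) x = comb (- l) k x.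
  move=> Wx; rewrite /comb /app mulmxDl -!scalemxAl (app_app (JJ Wx)).
  by rewrite scalerN scaleNr addrC.
have cJC k l : closed_on W (fun X => inner g X (app J (comb k l))).
  apply: (closed_on_ext oW _ (cC (- l) k)) => A x Wx.
  by rewrite /inner JC.
have sPhi := smooth_kahler_vector Ng cD.
have cK := conformal_connection_on oW Ng cD sPhi.
have tK := conformal_torsion_free (kahler_vector g D) Ng tD.
have wK := conformal_weyl_compatible (kahler_vector g D) Ng wD.
(* The first bracket of Q gives phi(Y) X - g(X, Y) phi^#; the summand -1/m in A removes the term
   phi(X) Y, which the Kaehler connection has and Q has not. The terms in l1 to l4 form a + i b, and
   l7 = -l5, l8 = -l6 let P account for l5 to l8. *)
pose A := comb (l1 / n%:R) (l3 / n%:R - m%:R^-1).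
pose B := comb (l2 / n%:R) (l4 / n%:R).
pose P := comb (l5 / n%:R) (l6 / n%:R).
have D'E A' B' : smooth A' -> smooth B' -> forall x, W x ->
    D' A' B' x = kahler_connection g D A' B' x
    + deviation (g x) (J x) (P x) (inner g A' A x) (inner g A' B x)
                (A' x) (B' x).
  move=> sA' sB' x Wx; rewrite /D' /nabla' /Q_tensor !(lie_formE _ _ Ng Wx).
  rewrite -/L /app !OmE// /kahler_connection /kahler_vector -/L.
  rewrite /conformal_connection /deviation /A /B /P /comb.
  rewrite /inner -!/(bil _ _ _) /app.
  rewrite !(mulmxDl, =^~ scalemxAl) (app_app (JJ Wx)).
  rewrite !(bilDr, bilZr, bilNr).
  rewrite !(bil_app (JJ Wx) (norden_J Ng Wx)) (app_app (JJ Wx)) ?bilNr.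
  move: (A' x *m J x) (B' x *m J x) (L x *m J x) (D A' B' x) => a' b' l d.
  move: (L x) (A' x) (B' x) => l0 a b.
  have n0 : n%:R != 0 :> R by rewrite pnatr_eq0 -lt0n (ltn_trans _ n2).
  apply/rowP => i; rewrite !mxE natrM.
  by field.
pose S := deviation_matrix J g (kahler_connection g D) (kahler_vector g D) P q.
have SJ : J q *m S *m (J q)^T = - S.
  apply: (deviation_matrix_norden oW sJ (norden_sym Ng) JJ (norden_J Ng) cK tK
    wK jD _ _ _ Wq); [exact: sC|exact: cC|exact: cJC].
have LE X' Y' Z' V' : smooth X' -> smooth Y' -> smooth Z' -> smooth V' ->
    curvature4 g D' X' Y' Z' V' q =
    curvature4 g (kahler_connection g D) X' Y' Z' V' q
    - psi12 J g S X' Y' Z' V' q.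
  move=> sX' sY' sZ' sV'.
  exact: (curvature4_deviation oW sJ (norden_smooth Ng) (norden_sym Ng) JJ
    (norden_J Ng) cK tK wK jD (sC _ _) (sC _ _) (sC _ _) (cC _ _) (cC _ _)
    D'E sX' sY' sZ' sV' Wq).
rewrite (bochnerB g (@smooth_frame R m W) (smooth_app oW sJ) LE sX sY sZ sV).
rewrite (bochner_psi12 (norden_unit Ng Wq) (norden_sym Ng Wq) (JJ Wq)
  (norden_J Ng Wq) SJ _ _ _ _ n2).
by rewrite subr0.
Qed.

End LieForms.

(** * Passage to a chart *)

Section Chart.
Variables (R : realType) (n : nat) (M : manifold R (2 * n)).
Local Notation m := (2 * n)%N.
Local Notation E := 'rV[R]_m.
Local Notation vf := (E -> E).
Variables (c : chart M) (W : set E).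
Hypothesis lW : local_open c W.
Local Notation smooth := (smooth_on W).

Lemma local_connection (D : connection M) :
  is_connection D -> connection_on W (D c).
Proof.
move=> cD; split.
- by move=> X Y; exact: connection_smooth cD c W X Y lW.
- by move=> f X1 X2 Y; exact: connection_lin cD c W f X1 X2 Y lW.
- by move=> X Y1 Y2; exact: connection_add cD c W X Y1 Y2 lW.
- by move=> f X Y; exact: connection_leibniz cD c W f X Y lW.
Qed.

Lemma local_levi_civita (g : matrix_field M) (D : connection M) :
  is_levi_civita g D ->
  [/\ connection_on W (D c), torsion_free W (D c)
    & weyl_compatible W (g c) (D c) (fun=> 0)].
Proof.
move=> lcD; split.
- exact: local_connection (levi_civita_connection lcD).
- by move=> X Y; exact: levi_civita_torsion lcD c W X Y lW.
- move=> X Y Z sX sY sZ q Wq.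
  rewrite (levi_civita_metric lcD lW sX sY sZ Wq).
  have -> : inner (g c) X (fun=> 0) q = 0 by rewrite /inner trmx0 mulmx0 mxE.
  by rewrite mulr0 mul0r subr0.
Qed.

Lemma local_norden (J g : matrix_field M) : is_norden J g ->
  [/\ smooth (J c), forall q, W q -> J c q *m J c q = - 1%:M
    & norden_on W (J c) (g c)].
Proof.
move=> [[sJ _ JJ] [sg _ gs gU] gJ]; have [_ Wc] := lW; split.
- exact: smooth_on_sub Wc (sJ c).
- by move=> q /Wc; exact: JJ.
- split.
  + exact: smooth_on_sub Wc (sg c).
  + by move=> q /Wc; exact: gU.
  + by move=> q /Wc; exact: gs.
  + move=> q /Wc cq; apply: bil_ext => v w.
    by rewrite bilNm -bil_mulmxr -bil_mulmxl /bil gJ// mxE.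
Qed.

Lemma local_lie_vector (J g : matrix_field M) (D : connection M)
    (Omega : vector_field M) :
  norden_on W (J c) (g c) -> is_lie_vector J g D Omega ->
  forall q, W q -> Omega c q = lie_vector (J c) (g c) (D c) q.
Proof.
move=> Ng OmE q Wq; apply: (bil_inj (norden_unit Ng Wq)) => a.
have := OmE c W (frame a) lW (smooth_frame W a) q Wq.
rewrite (lie_formE _ _ Ng Wq) /inner -!/(bil _ _ _) => e.
rewrite (bilC (Omega c q) _ (norden_sym Ng Wq)) -[delta_mx 0 a]/(frame a q).
by rewrite -e (bilC _ _ (norden_sym Ng Wq)).
Qed.

End Chart.

Theorem theorem4p2 (R : realType) (n : nat) (M : manifold R (2 * n))
    (J g : matrix_field M) (D : connection M) (Omega : vector_field M)
    (u : M -> R) (Dbar : connection M) (Omegabar : vector_field M)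
    (l1 l2 l3 l4 l5 l6 l7 l8 : R) :
  (6 <= 2 * n)%N ->
  is_conformal_kahler_norden J g D ->
  is_lie_vector J g D Omega ->
  l7 = - l5 -> l8 = - l6 ->
  smooth_function u -> pluriharmonic J u ->
  let gbar := conformal_metric u g in
  is_levi_civita gbar Dbar ->
  is_lie_vector J gbar Dbar Omegabar ->
  forall (c : chart M) (W : set 'rV[R]_(2 * n))
    (X Y Z V : 'rV[R]_(2 * n) -> 'rV[R]_(2 * n)),
  local_open c W ->
  smooth_on W X -> smooth_on W Y -> smooth_on W Z -> smooth_on W V ->
  let D' := nabla' n l1 l2 l3 l4 l5 l6 l7 l8 (J c) (g c) (D c) (Omega c) in
  let Dbar' :=
    nabla' n l1 l2 l3 l4 l5 l6 l7 l8 (J c) (gbar c) (Dbar c) (Omegabar c) in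
  let R' := curvature4 (g c) D' in
  let Rbar' := curvature4 (gbar c) Dbar' in
  forall q, W q ->
  bochner n (J c) (gbar c) Rbar' X Y Z V q =
  expR (2 * u (param c q)) * bochner n (J c) (g c) R' X Y Z V q.
Proof.
move=> n6 [nord lc W1 clT clTs] OmE l7E l8E su phu gbar lcb OmbE.
move=> c W X Y Z V lW sX sY sZ sV D' Dbar' R' Rbar' q Wq.
have n2 : (2 < n)%N by move: n6; rewrite -[6%N]/(2 * 3)%N leq_pmul2l.
have m0 : (0 < 2 * n)%N by exact: leq_trans n6.
have [oW Wc] := lW.
have [sJ JJ Ng] := local_norden lW nord.
have [cD tD wD] := local_levi_civita lW lc.
have [cDb tDb wDb] := local_levi_civita lW lcb.
pose f : 'rV[R]_(2 * n) -> R := u \o param c.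
have sf : smooth_on W f by exact: smooth_on_sub Wc (su c).
have gbE q' : W q' -> gbar c q' = expR (2 * f q') *: g c q' by [].
have Ngb := norden_conformal oW Ng sf gbE.
have cL : closed_on W
    (fun A => inner (g c) A (lie_vector (J c) (g c) (D c))).
  apply: (closed_on_ext oW (w := lie_form (J c) (g c) (D c))).
    by move=> A q' Wq'; exact: lie_formE Ng Wq'.
  by move=> A B sA sB q' Wq'; exact: clT lW sA sB q' Wq'.
have cLJ : closed_on W
    (fun A => inner (g c) A (app (J c) (lie_vector (J c) (g c) (D c)))).
  apply: (closed_on_ext oW (w := lie_form_star (J c) (g c) (D c))).
    move=> A q' Wq'; rewrite /lie_form_star (lie_formE _ _ Ng Wq').
    exact: bil_app (JJ _ Wq') (norden_J Ng Wq') _ _.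
  by move=> A B sA sB q' Wq'; exact: clTs lW sA sB q' Wq'.
have jD : complex_connection W (J c) (kahler_connection (J c) (g c) (D c)).
  apply: (W1_complex JJ Ng) => A B C sA sB sC q' Wq'.
  by exact: W1 lW sA sB sC q' Wq'.
have phW : closed_on W (fun A => along (app (J c) A) f).
  by move=> A B sA sB q' Wq'; exact: phu c W A B lW sA sB q' Wq'.
have cLb := closed_lie_vector_conformal oW sJ JJ Ng m0 sf cD tD wD gbE tDb wDb
  cL phW.
have cLJb := closed_lie_vector_star_conformal oW sJ JJ Ng m0 sf cD tD wD gbE
  tDb wDb cLJ.
have Kconf A B q' sA sB Wq' := kahler_connection_conformal (X := A) (Y := B)
  (q := q') oW sJ JJ Ng m0 sf cD tD wD gbE tDb wDb sA sB Wq'.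
(* The W1 identity is given for g; the Kaehler connection of gbar is complex because it coincides
   with that of g. *)
have jDb : complex_connection W (J c)
    (kahler_connection (J c) (gbar c) (Dbar c)).
  move=> A B sA sB q' Wq'.
  have sJB : smooth_on W (app (J c) B) by exact: smooth_app.
  rewrite (Kconf A _ q' sA sJB Wq') (Kconf A B q' sA sB Wq').
  exact: jD.
have OmL := local_lie_vector lW Ng OmE.
have OmbL := local_lie_vector lW Ngb OmbE.
rewrite (bochner_nabla' oW sJ JJ _ _ _ _ n2 Ngb cDb tDb wDb jDb cLb cLJb OmbL
  l7E l8E sX sY sZ sV Wq).
rewrite (bochner_nabla' oW sJ JJ _ _ _ _ n2 Ng cD tD wD jD cL cLJ OmL l7E l8E
  sX sY sZ sV Wq).
(* Both sides are now Bochner tensors of Kaehler connections; the scaling by c = e^(2u) remains. *)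
apply: (bochner_conformal (@smooth_frame R _ W) (smooth_app oW sJ)
  (norden_unit Ng Wq) _ (gbE q Wq) _ sX sY sZ sV).
  by rewrite gt_eqF// expR_gt0.
move=> A B C N sA sB sC sN.
exact: (curvature4_kahler_conformal oW sJ JJ Ng m0 sf cD tD wD gbE cDb tDb wDb
  sA sB sC sN Wq).
Qed.
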